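(* Let $\mathbb F$ be a free group of finite rank $r\ge 2$ with a fixed basis $\mathcal B$, and let $k$ be a positive integer. Then for a random cyclic peripheral structure $\mathcal P$ on $\mathbb F$, the Bowditch boundary $\partial(\mathbb F,\mathcal P)$ does not contain a cut set of size less than $k$. Explicitly, this holds in both of the following models. (1) (Few words model.) Fix an integer $m\ge 1$. For each $n\geq 1$ let $w_1,\dots,w_m$ be chosen independently and uniformly at random from the nontrivial elements of $\mathbb F$ of length at most $n$ with respect to $\mathcal B$, and let $\mathcal P$ be the peripheral structure induced by $\{w_1,\dots,w_m\}$. Then the probability that $\partial(\mathbb F,\mathcal P)$ is connected and has no cut set with fewer than $k$ elements tends to $1$ as $n\to\infty$. (2) (Density model.) Fix $d\in(0,1)$. For each $n\geq 1$ let $w_1,\dots,w_N$, with $N=\lfloor (2r-1)^{dn}\rfloor$, be chosen independently and uniformly at random from the elements of $\mathbb F$ of length $n$ with respect to $\mathcal B$, and let $\mathcal P$ be the peripheral structure induced by $\{w_1,\dots,w_N\}$. Then the probability that $\partial(\mathbb F,\mathcal P)$ is connected and has no cut set with fewer than $k$ elements tends to $1$ as $n\to\infty$.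
   Context: Elements of $\mathbb F$ are identified with reduced words in $\mathcal B^{\pm1}$. For a nontrivial $w\in\mathbb F$, $w'$ denotes its cyclic reduction and $\sqrt{w}$ denotes the shortest word with $w=(\sqrt w)^i$ for some $i \geq 1$. A peripheral structure on a group $G$ is a set $\mathcal P$ of infinite subgroups, each equal to its own normalizer, closed under conjugation in $G$. The peripheral structure induced by a finite set $\{g_1,\dots,g_s\}$ of nontrivial elements of $\mathbb F$ is the set of all conjugates of the subgroups $\langle\sqrt{g_i'}\rangle$; $\mathbb F$ is hyperbolic relative to it. $\partial(\mathbb F,\mathcal P)$ is the Bowditch boundary of the relatively hyperbolic pair $(\mathbb F,\mathcal P)$. For the structure induced by $\{g_1,\dots,g_s\}$ it is identified with the following decomposition space. Let $\mathcal T$ be the Cayley tree of $\mathbb F$ with respect to $\mathcal B$ and $\partial\mathcal T$ its Gromov boundary. For a cyclically reduced word $g$ that is not a proper power, a $g$-line is the geodesic in $\mathcal T$ containing the vertices $\{hg^j\}_{j\in\mathbb Z}$, for some $h\in\mathbb F$. Let $\mathcal L$ be the set of all $\sqrt{g_i'}$-lines, $1\le i\le s$. Then $\partial(\mathbb F,\mathcal P)$ is the quotient space of $\partial\mathcal T$ obtained by identifying the two endpoints of each line in $\mathcal L$. When $\partial(\mathbb F,\mathcal P)$ is connected, a cut set is a finite subset $S\subseteq\partial(\mathbb F,\mathcal P)$ such that $\partial(\mathbb F,\mathcal P)\setminus S$ is disconnected. *)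

(* Defs.v *)
From HB Require Import structures.
From Stdlib Require Import Relations.
From mathcomp Require Import all_boot all_order all_algebra.
From mathcomp Require Import all_classical all_reals all_analysis.

Set Implicit Arguments.
Unset Strict Implicit.
Unset Printing Implicit Defensive.

Import numFieldNormedType.Exports.
Local Open Scope classical_set_scope.
Local Open Scope group_scope.

Section FreeGroup.
Variable r : nat.

(* [(i, true)] is the [i]-th basis element and [(i, false)] its inverse. *)
Definition letter : finType := ('I_r * bool)%type.

Definition linv (a : letter) : letter := (a.1, ~~ a.2).

Definition no_cancel : rel letter := fun a b => b != linv a.

Definition reduced : pred (seq letter) := sorted no_cancel.

Definition cyclically_reduced : pred (seq letter) := cycle no_cancel.

Record free_group := FreeGroup { word :> seq letter ; _ : reduced word }.

HB.instance Definition _ := [isSub for word].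
HB.instance Definition _ := [Countable of free_group by <:].

Lemma free_groupP (w : free_group) : reduced w.
Proof. by case: w. Qed.

Definition push (a : letter) (s : seq letter) : seq letter :=
  if s is b :: s' then if no_cancel a b then a :: s else s' else [:: a].

Definition reduce (s : seq letter) : seq letter := foldr push [::] s.

Definition winv (s : seq letter) : seq letter := rev (map linv s).

Lemma linvK : involutive linv.
Proof. by case=> i b; rewrite /linv /= negbK. Qed.

Lemma no_cancel_linv a b : no_cancel (linv b) (linv a) = no_cancel a b.
Proof.
by rewrite /no_cancel linvK; apply/idP/idP; apply: contra => /eqP->;
  rewrite ?linvK.
Qed.

Lemma push_reduced a s : reduced s -> reduced (push a s).
Proof.
case: s => [|b s] //= Hs; case: ifP => [ab|_]; first by rewrite /= ab.
exact: path_sorted Hs.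
Qed.

Lemma reduce_reduced s : reduced (reduce s).
Proof. by elim: s => //= a s; exact: push_reduced. Qed.

Lemma reduce_id s : reduced s -> reduce s = s.
Proof.
elim: s => //= a s IH Hs; rewrite IH; last exact: path_sorted Hs.
by case: s Hs {IH} => //= b s /andP[-> _].
Qed.

Lemma pushK a s : reduced s -> push a (push (linv a) s) = s.
Proof.
case: s => [|b s] /= Hs; first by rewrite /no_cancel eqxx.
rewrite {1}/no_cancel linvK; case: (eqVneq b a) Hs => [-> Hs|_ _] /=.
  by case: s Hs => //= c s /andP[-> _].
by rewrite /no_cancel eqxx.
Qed.

Lemma reduce_cat s t : reduce (s ++ t) = foldr push (reduce t) s.
Proof. by rewrite /reduce foldr_cat. Qed.

Lemma foldr_push_reduced s t : reduced t -> reduced (foldr push t s).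
Proof. by move=> Ht; elim: s => //= a s; exact: push_reduced. Qed.

Lemma foldr_push_push a s t : reduced t ->
  foldr push t (push a s) = push a (foldr push t s).
Proof.
move=> Ht; case: s => [|b s] //=; case: ifPn => //=.
rewrite /no_cancel negbK => /eqP->.
by rewrite pushK //; exact: foldr_push_reduced.
Qed.

Lemma foldr_push_reduce s t : reduced t ->
  foldr push t (reduce s) = foldr push t s.
Proof. by move=> Ht; elim: s => //= a s IH; rewrite foldr_push_push ?IH. Qed.

Lemma winvK : involutive winv.
Proof. by move=> s; rewrite /winv map_rev revK mapK //; exact: linvK. Qed.

Lemma winv_reduced s : reduced s -> reduced (winv s).
Proof.
rewrite /reduced /winv rev_sorted sorted_map => Hs.
by apply: sub_sorted Hs => a b /=; rewrite no_cancel_linv.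
Qed.

Lemma foldr_push_winv s t : reduced t ->
  foldr push (foldr push t (winv s)) s = t.
Proof.
elim: s t => //= a s IH t Ht.
rewrite /winv /= rev_cons foldr_rcons -/(winv s) IH ?pushK //.
exact: push_reduced.
Qed.

Definition free_one : free_group := FreeGroup (isT : reduced [::]).

Definition free_inv (u : free_group) : free_group :=
  FreeGroup (winv_reduced (free_groupP u)).

Definition free_mul (u v : free_group) : free_group :=
  FreeGroup (reduce_reduced (u ++ v)).

Fact free_mulA : associative free_mul.
Proof.
move=> u v w; apply: val_inj => /=.
rewrite [LHS]reduce_cat [RHS]reduce_cat (reduce_id (reduce_reduced _)).
have Hw : reduced (reduce w) by exact: reduce_reduced.
by rewrite (foldr_push_reduce _ Hw) foldr_cat (reduce_cat v w).
Qed.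

Fact free_mul1g : left_id free_one free_mul.
Proof. by move=> u; apply: val_inj; rewrite /= reduce_id //; exact: free_groupP. Qed.

Fact free_mulg1 : right_id free_one free_mul.
Proof.
by move=> u; apply: val_inj; rewrite /= cats0 reduce_id //; exact: free_groupP.
Qed.

Fact free_mulgV : right_inverse free_one free_inv free_mul.
Proof.
move=> u; apply: val_inj => /=; rewrite reduce_cat /reduce.
exact: foldr_push_winv.
Qed.

Fact free_mulVg : left_inverse free_one free_inv free_mul.
Proof.
move=> u; rewrite -[X in free_mul _ X = _](_ : free_inv (free_inv u) = u).
  exact: free_mulgV.
by apply: val_inj; rewrite /= winvK.
Qed.

HB.instance Definition _ := isGroup.Build free_group
  free_mulA free_mul1g free_mulg1 free_mulVg free_mulgV.

(* In [cyclic_reduction] and [free_root], [xget] selects the unique element with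
   the given property; the default [1] is never used. *)
Definition is_cyclic_reduction (w v : free_group) : Prop :=
  cyclically_reduced v /\ exists u : free_group, word w = u ++ v ++ winv u.

Definition cyclic_reduction (w : free_group) : free_group :=
  xget 1 [set v | is_cyclic_reduction w v].

Definition is_free_root (w v : free_group) : Prop :=
  (exists2 i : nat, 1 <= i & w = v ^+ i)%N /\
  forall (u : free_group) (i : nat),
    (1 <= i)%N -> w = u ^+ i -> (size v <= size u)%N.

Definition free_root (w : free_group) : free_group :=
  xget 1 [set v | is_free_root w v].

Definition cyclic_subgroup (g : free_group) : set free_group :=
  [set x | exists j : nat, x = g ^+ j \/ x = g ^- j].

Definition induced_peripheral_structure (A : set free_group) :
    set (set free_group) :=
  [set H | exists g h : free_group, A g /\
     H = [set x ^ h | x in cyclic_subgroup (free_root (cyclic_reduction g))]].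

(* The Cayley tree has the edges [{u, u * a}], [a] a letter, so that its path
   metric on vertices is the following. *)
Definition tree_dist (u v : free_group) : nat := size (u^-1 * v).

(* Geodesics in the tree are given by the sequences of vertices they visit. *)
Definition geodesic_line (gamma : int -> free_group) : Prop :=
  forall i j : int, tree_dist (gamma i) (gamma j) = `|i - j|%N.

Definition is_line_of (g : free_group) (gamma : int -> free_group) : Prop :=
  geodesic_line gamma /\
  exists h : free_group, forall j : nat,
    range gamma (h * g ^+ j) /\ range gamma (h * g ^- j).

Definition based_geodesic_ray : set (prod_topology (fun _ : nat =>
    discrete_topology free_group)) :=
  [set rho | rho 0%N = 1 /\
     forall i j : nat, tree_dist (rho i) (rho j) = `|i - j|%N].

(* Every point of the Gromov boundary of the tree is represented by exactly one
   geodesic ray issuing from the vertex [1]; the topology is that of pointwise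
   convergence of such rays. *)
Definition tree_boundary : Type := set_type based_geodesic_ray.
HB.instance Definition _ := Topological.on tree_boundary.

Definition asymptotic (rho sigma : nat -> free_group) : Prop :=
  exists C : nat, forall i, (tree_dist (rho i) (sigma i) <= C)%N.

Definition endpoints (gamma : int -> free_group) (x y : tree_boundary) : Prop :=
  asymptotic (set_val x) (fun n => gamma (Posz n)) /\
  asymptotic (set_val y) (fun n => gamma (- Posz n)%R).

(* The lines used for a structure induced by a finite set [A]; different [A]
   inducing the same structure give the same lines. *)
Definition peripheral_lines (P : set (set free_group)) :
    set (int -> free_group) :=
  [set gamma | exists A : set free_group,
     [/\ finite_set A, ~ A 1, P = induced_peripheral_structure A &
         exists2 g, A g & is_line_of (free_root (cyclic_reduction g)) gamma]].

(* For a structure induced by finitely many elements, the Bowditch boundary is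
   the decomposition space obtained from the boundary of the tree by identifying
   the two endpoints of each peripheral line. *)
Section BowditchBoundary.
Variable P : set (set free_group).

Definition joined (x y : tree_boundary) : Prop :=
  exists2 gamma, peripheral_lines P gamma & endpoints gamma x y.

Definition identified : rel tree_boundary :=
  fun x y => `[< clos_refl_sym_trans tree_boundary joined x y >].

Fact identified_refl : reflexive identified.
Proof. by move=> x; apply/asboolP; exact: rst_refl. Qed.

Fact identified_sym : symmetric identified.
Proof. by move=> x y; apply/asboolP/asboolP; exact: rst_sym. Qed.

Fact identified_trans : transitive identified.
Proof.
by move=> y x z /asboolP xy /asboolP yz; apply/asboolP; exact: rst_trans yz.
Qed.

Canonical identified_equiv :=
  EquivRel identified identified_refl identified_sym identified_trans.

Definition bowditch_boundary : topologicalType :=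
  quotient_topology {eq_quot identified}%qT.

End BowditchBoundary.

Definition nontrivial_ball (n : nat) : finType :=
  {w : n.-bseq letter | reduced w && (0 < size w)%N}.

Definition sphere (n : nat) : finType := {w : n.-tuple letter | reduced w}.

Definition ball_elt n (w : nontrivial_ball n) : free_group :=
  FreeGroup (proj1 (andP (valP w))).

Definition sphere_elt n (w : sphere n) : free_group := FreeGroup (valP w).

End FreeGroup.

Definition cut_set (X : topologicalType) (S : set X) : Prop :=
  finite_set S /\ ~ connected (~` S).

Definition connected_without_small_cut_set (X : topologicalType) (k : nat) :
    Prop :=
  connected [set: X] /\
  forall (S : set X) (j : nat), cut_set S -> (S #= `I_j)%card -> (k <= j)%N.

Definition counting_prob (R : realType) (T : finType) (E : set T) : R :=
  (#|[pred x : T | `[< E x >]]|%:R / #|T|%:R)%R.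

(* [m] independent uniform elements of a finite set [T] form a uniform element
   of [T ^ m]. *)
Definition few_words_prob (R : realType) (r k m n : nat) : R :=
  counting_prob R
    [set w : {ffun 'I_m -> nontrivial_ball r n} |
       connected_without_small_cut_set
         (bowditch_boundary
            (induced_peripheral_structure
               [set ball_elt (w i) | i in [set: 'I_m]])) k].

Definition density_count (R : realType) (r : nat) (d : R) (n : nat) : nat :=
  Num.truncn (((2 * r - 1)%N%:R : R) `^ (d * n%:R))%R.

Definition density_prob (R : realType) (r k : nat) (d : R) (n : nat) : R :=
  let N := density_count r d n in
  counting_prob R
    [set w : {ffun 'I_N -> sphere r n} |
       connected_without_small_cut_set
         (bowditch_boundary
            (induced_peripheral_structure
               [set sphere_elt (w i) | i in [set: 'I_N]])) k].

(* Main.v *)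
Require Import Defs.
From mathcomp Require Import all_boot all_order all_algebra.
From mathcomp Require Import all_classical all_reals all_analysis.
From mathcomp Require Import zify.
Import numFieldNormedType.Exports.

(** A finite set of points of the boundary has a preimage in [tree_boundary]
    with at most twice as many points: two peripheral lines with one common
    end share both ends, because suitable powers of the corresponding
    elements coincide. Suppose that every reduced word of length at most
    [4k] is a factor of a power of one of the roots, so that short geodesic
    segments all extend to peripheral lines, and colour the complement of
    the removed points according to a separation of the quotient. A cylinder
    without removed points is monochromatic, as lines connect its
    sub-cylinders and the colour is locally constant. Fewer than [2k - 1]
    removed points cannot block all the branches off [2k - 1] consecutive
    edges, so that a line connects a free cylinder to a free cylinder closer
    to the origin, and finally to one at distance at most [2k]; these are
    connected to each other by lines as well. So there is a single colour.

    A single random word suffices to provide these factors: its first and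
    last [t] letters are rarely inverse to each other, and it rarely avoids,
    after its first and before its last [t] letters, a fixed word containing
    all the short ones. *)

Set Implicit Arguments.
Unset Strict Implicit.
Unset Printing Implicit Defensive.

(** * Reduced words *)

Section Words.
Variable r : nat.
Implicit Types (a b c : letter r) (s t : seq (letter r)) (u v w : free_group r).

Lemma no_cancelC a b : no_cancel a b = no_cancel b a.
Proof.
by rewrite /no_cancel; apply/idP/idP; apply: contra => /eqP->; rewrite linvK.
Qed.

Lemma no_cancel_linvl a b : no_cancel (linv a) b = (a != b).
Proof. by rewrite /no_cancel linvK eq_sym. Qed.

Lemma winv_cat s t : winv (s ++ t) = winv t ++ winv s.
Proof. by rewrite /winv map_cat rev_cat. Qed.

Lemma size_winv s : size (winv s) = size s.
Proof. by rewrite size_rev size_map. Qed.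

Lemma winv_cons a s : winv (a :: s) = rcons (winv s) (linv a).
Proof. by rewrite /winv /= rev_cons. Qed.

Lemma reduced_winv s : reduced (winv s) = reduced s.
Proof.
by apply/idP/idP => [/winv_reduced|/winv_reduced//]; rewrite winvK.
Qed.

Lemma reduced_catW s t : reduced (s ++ t) -> reduced s /\ reduced t.
Proof. by move=> /cat_sorted2[]. Qed.

Lemma reduced_cat_cons s b t :
  reduced (s ++ b :: t) = reduced (rcons s b) && reduced (b :: t).
Proof. by rewrite /reduced sorted_cat_cons. Qed.

Lemma reduced_rcons2 s a b :
  reduced (rcons (rcons s a) b) = reduced (rcons s a) && no_cancel a b.
Proof.
by case: s => [|c s]; rewrite /reduced /= ?andbT // rcons_path last_rcons.
Qed.

Lemma reduced_rcons_cat_cons s a b t :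
  reduced (rcons s a ++ b :: t) =
    [&& reduced (rcons s a), no_cancel a b & reduced (b :: t)].
Proof. by rewrite reduced_cat_cons reduced_rcons2 andbA. Qed.

(** It also holds when one word is empty, so that it describes what is left of any two words once
    their longest common prefix is removed. *)
Definition heads_differ s t : bool :=
  if s is a :: _ then if t is b :: _ then a != b else true else true.

Lemma reduced_winv_cat s t : reduced s -> reduced t -> heads_differ s t ->
  reduced (winv s ++ t).
Proof.
case: s => [|a s] //; case: t => [|b t] rs rt /= ab.
  by rewrite cats0 reduced_winv.
rewrite winv_cons reduced_rcons_cat_cons -winv_cons reduced_winv rs rt.
by rewrite no_cancel_linvl ab.
Qed.

Lemma size_push a s : size (push a s) <= (size s).+1.
Proof. by case: s => [|b s] //=; case: ifP => //= _; rewrite leqW. Qed.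

Lemma size_reduce s : size (reduce s) <= size s.
Proof. by elim: s => //= a s IH; apply: leq_trans (size_push _ _) _. Qed.

(** A letter cancelled by [push] lowers the final size, so equality of sizes means that nothing was
    cancelled. *)
Lemma reduce_size_eq s : size (reduce s) = size s -> reduce s = s.
Proof.
elim: s => //= a s IH; have := size_reduce s; move: IH; move: (reduce s).
case=> [|b s'] IH /=.
  by case: s IH => // _ _.
case: ifP => [_|_] /= le_s e; last by move: e le_s; lia.
by congr (_ :: _); apply: IH => /=; lia.
Qed.

Definition elt s : free_group r := FreeGroup (reduce_reduced s).

Lemma elt_word w : elt (word w) = w.
Proof. by apply: val_inj; rewrite /= reduce_id // free_groupP. Qed.

Lemma word_elt s : reduced s -> word (elt s) = s.
Proof. exact: reduce_id. Qed.

Lemma elt_cat s t : elt (s ++ t) = (elt s * elt t)%g.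
Proof.
apply: val_inj; rewrite /= /mul /= !reduce_cat.
by rewrite (reduce_id (reduce_reduced t)) foldr_push_reduce ?reduce_reduced.
Qed.

Lemma elt_winv s : elt (winv s) = (elt s)^-1%g.
Proof.
apply: (mulgI (elt s)); rewrite -elt_cat mulgV; apply: val_inj => /=.
by rewrite reduce_cat /reduce foldr_push_winv.
Qed.

Lemma elt_nil : elt [::] = 1%g.
Proof. exact: val_inj. Qed.

Lemma elt_nseq n s : elt (flatten (nseq n s)) = (elt s ^+ n)%g.
Proof.
elim: n => [|n IH] /=; first exact: elt_nil.
by rewrite elt_cat IH expgS.
Qed.

Lemma size_mulg u v : size (u * v)%g <= size u + size v.
Proof. by rewrite -size_cat; exact: size_reduce. Qed.

Lemma size_invg u : size (u^-1)%g = size u.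
Proof. exact: size_winv. Qed.

Lemma tree_distC u v : tree_dist u v = tree_dist v u.
Proof. by rewrite /tree_dist -size_invg invgM invgK. Qed.

Lemma tree_dist_triangle u v w :
  tree_dist u w <= tree_dist u v + tree_dist v w.
Proof.
have -> : tree_dist u w = size ((u^-1 * v) * (v^-1 * w))%g.
  by rewrite mulgA mulgK.
exact: size_mulg.
Qed.

Lemma tree_dist_mull w u v : tree_dist (w * u)%g (w * v)%g = tree_dist u v.
Proof. by rewrite /tree_dist invgM mulgA mulgVK. Qed.

Lemma tree_dist_mulr u v : tree_dist u (u * v)%g = size v.
Proof. by rewrite /tree_dist mulKg. Qed.

Lemma tree_dist_elt_cat s t t' :
  tree_dist (elt (s ++ t)) (elt (s ++ t')) = size (reduce (winv t ++ t')).
Proof.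
by rewrite !elt_cat tree_dist_mull /tree_dist -elt_winv -elt_cat.
Qed.

(** Equality in the triangle inequality: no letter cancels in the product of [u] and [u^-1 * v]. *)
Lemma prefix_of_dist u v :
  size u + tree_dist u v = size v -> prefix u v.
Proof.
rewrite /tree_dist => e; have ev : v = (u * (u^-1 * v))%g by rewrite mulVKg.
have ev' : word v = reduce (u ++ (u^-1 * v)%g) by rewrite {1}ev.
have := @reduce_size_eq (u ++ (u^-1 * v)%g).
rewrite -ev' size_cat => /(_ (esym e)) ->; exact: prefix_prefix.
Qed.

Lemma split_lcp s t : exists z s' t',
  [/\ s = z ++ s', t = z ++ t' & heads_differ s' t'].
Proof.
elim: s t => [|a s IH] t; first by exists [::], [::], t.
case: t => [|b t]; first by exists [::], (a :: s), [::].
case: (eqVneq a b) => [<-|ab]; last by exists [::], (a :: s), (b :: t).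
by have [z [s' [t' [-> -> h]]]] := IH t; exists (a :: z), s', t'.
Qed.

End Words.

(** * Rays and lines of the Cayley tree *)

Section Rays.
Local Open Scope classical_set_scope.
Variable r : nat.
Implicit Types (a b c : letter r) (s t : seq (letter r)) (u v w : free_group r).
Implicit Types (x y z : tree_boundary r).

Definition ray_word x n : seq (letter r) := word (set_val x n).

Lemma reduced_ray_word x n : reduced (ray_word x n).
Proof. exact: free_groupP. Qed.

Lemma ray_dist x m n : tree_dist (set_val x m) (set_val x n) = `|m - n|%N.
Proof. by have [_ ->] := set_valP x. Qed.

Lemma size_ray_word x n : size (ray_word x n) = n.
Proof.
have [x0 _] := set_valP x; have := ray_dist x 0 n.
by rewrite /tree_dist [set_val x 0]x0 invg1 mul1g => ->; lia.
Qed.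

Lemma take_ray_word x m n : m <= n -> take m (ray_word x n) = ray_word x m.
Proof.
move=> mn; have: prefix (set_val x m) (set_val x n).
  apply: prefix_of_dist; rewrite ray_dist -!/(ray_word _ _) !size_ray_word; lia.
move=> /prefixP[s]; rewrite -!/(ray_word _ _) => ->.
by rewrite take_size_cat // size_ray_word.
Qed.

Lemma ray_word_inj x y : ray_word x =1 ray_word y -> x = y.
Proof.
move=> xy; apply: val_inj; apply: funext => n; apply: val_inj; exact: xy.
Qed.

Lemma reduced_mkseqP (f : nat -> letter r) :
  (forall n, no_cancel (f n) (f n.+1)) -> forall n, reduced (mkseq f n).
Proof.
move=> fr; elim=> [|n IH] //; rewrite mkseqS; case: n IH => [|n] IH //.
by rewrite mkseqS reduced_rcons2 -mkseqS IH fr.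
Qed.

Lemma mkseqD T (f : nat -> T) m n :
  mkseq f (m + n) = mkseq f m ++ mkseq (fun i => f (m + i)) n.
Proof.
by rewrite /mkseq iotaD map_cat add0n -{2}(addn0 m) iotaDl -map_comp.
Qed.

Lemma tree_dist_mkseq (f : nat -> letter r) s m n :
  (forall n, reduced (mkseq f n)) ->
  tree_dist (elt (s ++ mkseq f m)) (elt (s ++ mkseq f n)) = `|m - n|%N.
Proof.
move=> fr; wlog mn : m n / m <= n.
  case: (leqP m n) => [mn|/ltnW nm]; first exact.
  by rewrite tree_distC distnC; apply.
rewrite !elt_cat tree_dist_mull -{1}(subnKC mn) mkseqD elt_cat tree_dist_mulr.
rewrite word_elt ?size_mkseq; first lia.
by have := fr (m + (n - m)); rewrite mkseqD => /reduced_catW[].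
Qed.

Lemma ray_exists (f : nat -> letter r) : (forall n, reduced (mkseq f n)) ->
  exists x, forall n, ray_word x n = mkseq f n.
Proof.
move=> fr; have rhoP : based_geodesic_ray (fun n => elt (mkseq f n)).
  split=> [|m n]; first exact: elt_nil.
  exact: (@tree_dist_mkseq f [::]).
by exists (SigSub (mem_set rhoP)) => n; exact: word_elt.
Qed.

(** Rays that part after a common prefix [z] are at distance [2 * (n - size z)] at time [n]. If this
    stays bounded along the multiples of [T], the common prefix is arbitrarily long. *)
Lemma ray_dist_unbounded x y T C : 0 < T ->
  (forall j, tree_dist (set_val x (j * T)) (set_val y (j * T)) <= C) -> x = y.
Proof.
move=> T0 xyC; apply: ray_word_inj => i.
pose n := (i + C).+1 * T; have iCn : i + C < n.
  by rewrite /n; apply: leq_trans (leq_pmulr _ T0).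
have := xyC (i + C).+1; rewrite -/n.
have in_ : i <= n by apply: leq_trans (ltnW iCn); rewrite leq_addr.
rewrite -(take_ray_word x in_) -(take_ray_word y in_) /tree_dist.
have [z [s [t [es et st]]]] := split_lcp (ray_word x n) (ray_word y n).
have := reduced_ray_word x n; have := reduced_ray_word y n.
have := size_ray_word x n; have := size_ray_word y n.
rewrite -(elt_word (set_val x n)) -(elt_word (set_val y n)).
rewrite -!/(ray_word _ _) es et => sy sx /reduced_catW[_ ry].
move=> /reduced_catW[_ rx].
rewrite -/(tree_dist _ _) tree_dist_elt_cat reduce_id;
  last exact: reduced_winv_cat.
rewrite size_cat size_winv; move: sx sy; rewrite !size_cat => sx sy stC.
by rewrite !takel_cat //; lia.
Qed.

Lemma boundary_nbhs x (U : set (tree_boundary r)) : open U -> U x ->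
  exists n, forall y, ray_word y n = ray_word x n -> U y.
Proof.
case=> O oO <- Ox.
(* The sequences that agree with [x] up to [n] form a filter base, which converges to [x] because it
   does so in every coordinate. *)
pose F := filter_from [set: nat] (fun n =>
  [set rho : prod_topology (fun _ : nat => discrete_topology (free_group r)) |
     forall i, i <= n -> rho i = set_val x i]).
have FF : Filter F.
  apply: filter_from_filter; first by exists 0.
  move=> m n _ _; exists (maxn m n) => // rho h; split=> i im; apply: h; lia.
have : F --> (set_val x : prod_topology (fun _ : nat =>
    discrete_topology (free_group r))).
  apply/cvg_sup => i A [B [[D oD <-] Dx] BA].
  exists i => // rho h; apply: BA; rewrite /= /proj h //.
move=> /(_ O) []; first exact: open_nbhs_nbhs.
move=> n _ h; exists n => y yx; apply: h => i le_in.
apply: val_inj; rewrite -[LHS]/(ray_word y i) -[RHS]/(ray_word x i).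
by rewrite -(take_ray_word y le_in) -(take_ray_word x le_in) yx.
Qed.

End Rays.

(** * Cyclic reduction *)

Section CyclicWords.
Local Open Scope classical_set_scope.
Variable r : nat.
Implicit Types (a b c : letter r) (s t : seq (letter r)) (u v w : free_group r).

(** Only adjacent letters matter, and since [m] is nonempty each adjacent pair lies in [s ++ m] or
    in [m ++ t]. *)
Lemma reduced_overlap (s m t : seq (letter r)) : m != [::] ->
  reduced (s ++ m) -> reduced (m ++ t) -> reduced (s ++ m ++ t).
Proof.
case: m => // b m _; rewrite !cat_cons !reduced_cat_cons => /andP[sb _] mt.
by rewrite sb.
Qed.

Lemma no_cancel_refl a : no_cancel a a.
Proof. by case: a => i []; rewrite /no_cancel /linv xpair_eqE andbF. Qed.

Lemma cyclic_reduction_ex s : reduced s -> exists u v : seq (letter r),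
  s = u ++ v ++ winv u /\ cyclically_reduced v.
Proof.
have [n] := ubnP (size s); elim: n s => // n IH [|a s] le_n rs.
  by exists [::], [::].
case/lastP: s le_n rs => [|s b] le_n rs.
  by exists [::], [:: a]; rewrite /cyclically_reduced /= no_cancel_refl.
case ba: (no_cancel b a).
  exists [::], (a :: rcons s b); rewrite cats0; split=> //.
  by rewrite /cyclically_reduced /= rcons_path last_rcons ba andbT.
have eb : b = linv a.
  by move: ba; rewrite no_cancelC /no_cancel => /negbFE/eqP.
have rs' : reduced s.
  by move: rs; rewrite -cats1 -cat_cons => /reduced_catW[+ _];
    exact: path_sorted.
have [|u [v [-> cv]]] := IH s _ rs'.
  by move: le_n; rewrite /= size_rcons; lia.
by exists (a :: u), v; rewrite winv_cons eb /= -!cats1 -!catA.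
Qed.

End CyclicWords.

(** * Periodic words *)

Section Periodic.
Variables (r : nat) (a0 : letter r).
Implicit Types (a b c : letter r) (s t : seq (letter r)) (u v w : free_group r).

Definition periodic_letter s n := nth a0 s (n %% size s).

Lemma eq_periodic s m n :
  m = n %[mod size s] -> periodic_letter s m = periodic_letter s n.
Proof. by rewrite /periodic_letter => ->. Qed.

Lemma periodic_no_cancel s n : s != [::] -> cyclically_reduced s ->
  no_cancel (periodic_letter s n) (periodic_letter s n.+1).
Proof.
case: s => // a s _; rewrite /cyclically_reduced /= => /(pathP a0) cs.
rewrite /periodic_letter -addn1 -modnDml addn1.
have : n %% size (a :: s) < size (a :: s) by rewrite ltn_mod.
move: (n %% _) => i lti; have := cs i; rewrite size_rcons => /(_ lti).
rewrite -rcons_cons !nth_rcons lti; move: lti; rewrite /= ltnS.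
case: ltngtP => // [lti _|-> _]; first by rewrite modn_small.
by rewrite modnn.
Qed.

Lemma reduced_periodic s n : s != [::] -> cyclically_reduced s ->
  reduced (mkseq (periodic_letter s) n).
Proof. by move=> s0 cs; apply: reduced_mkseqP => i;
  exact: periodic_no_cancel. Qed.

Lemma mkseq_periodicD s j n :
  mkseq (periodic_letter s) (j * size s + n) =
    flatten (nseq j s) ++ mkseq (periodic_letter s) n.
Proof.
elim: j => [|j IH] //=; rewrite mulSn -addnA mkseqD -catA -IH; congr (_ ++ _).
  rewrite -[RHS](mkseq_nth a0); apply: (@eq_from_nth _ a0) => [|i].
    by rewrite !size_mkseq.
  by rewrite size_mkseq => lti; rewrite !nth_mkseq // /periodic_letter
    modn_small.
by apply: eq_mkseq => i; apply: eq_periodic; rewrite modnDl.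
Qed.

Lemma mkseq_periodic_mul s j :
  mkseq (periodic_letter s) (j * size s) = flatten (nseq j s).
Proof. by rewrite -[j * _]addn0 mkseq_periodicD cats0. Qed.

End Periodic.

(** * Roots *)

Section Roots.
Local Open Scope classical_set_scope.
Variables (r : nat).
Implicit Types (a b c : letter r) (s t : seq (letter r)) (u v w : free_group r).

Lemma reduced_power s j : cyclically_reduced s -> reduced (flatten (nseq j s)).
Proof.
case: s => [|a s] cs; first by elim: j.
by rewrite -(mkseq_periodic_mul a) reduced_periodic.
Qed.

Lemma word_expg u j : cyclically_reduced u ->
  word (u ^+ j)%g = flatten (nseq j (word u)).
Proof.
by move=> cu; rewrite -{1}(elt_word u) -elt_nseq word_elt // reduced_power.
Qed.

Lemma cyclic_reductionP w : is_cyclic_reduction w (cyclic_reduction w).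
Proof.
apply: xgetPex; have [u [v [ew cv]]] := cyclic_reduction_ex (free_groupP w).
have := free_groupP w; rewrite ew => /reduced_catW[ru /reduced_catW[rv _]].
by exists (FreeGroup rv); split => //; exists (FreeGroup ru).
Qed.

Lemma cyclic_reduction_eq1 w : cyclic_reduction w = 1%g -> w = 1%g.
Proof.
move=> e; have [_ [u]] := cyclic_reductionP w; rewrite e /= => ew.
by rewrite -(elt_word w) ew elt_cat elt_winv mulgV.
Qed.

Lemma free_rootP w : is_free_root w (free_root w).
Proof.
apply: xgetPex.
pose P n := `[< exists u i, [/\ 1 <= i, w = (u ^+ i)%g & size u = n] >].
have [|n /asboolP[u [i [i0 wu <-]]] nmin] := @ex_minnP P.
  by exists (size w); apply/asboolP; exists w, 1.
exists u; split; first by exists i.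
by move=> u' i' i'0 wu'; apply: nmin; apply/asboolP; exists u', i'.
Qed.

(** If the root is [c ++ t ++ winv c] with [t] cyclically reduced, then [v] is the reduced word [c],
    [i] copies of [t], [winv c]. For nonempty [c] its last letter would be inverse to its first. *)
Lemma cyclically_reduced_root v : v != 1%g -> cyclically_reduced v ->
  cyclically_reduced (free_root v).
Proof.
move=> v1 cv; have [[i i0 vu] _] := free_rootP v.
move: (free_root v) vu => u vu.
have [c [t [eu ct]]] := cyclic_reduction_ex (free_groupP u).
have t0 : t != [::].
  apply: contraNneq v1 => t0; rewrite vu -(elt_word u) eu t0 /= elt_cat
    elt_winv.
  by rewrite mulgV expg1n.
have := free_groupP u; rewrite eu => ru.
have rct : reduced (c ++ t) by move: ru; rewrite catA => /reduced_catW[].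
have rtc : reduced (t ++ winv c) by move: ru => /reduced_catW[].
have flatC j : flatten (nseq j.+1 t) = flatten (nseq j t) ++ t.
  by elim: j => /= [|j IH]; rewrite ?cats0 // {1}IH catA.
have ev : word v = c ++ flatten (nseq i t) ++ winv c.
  rewrite -[RHS]word_elt; last first.
    case: i i0 {vu} => // i _; rewrite flatC -catA catA;
      apply: reduced_overlap => //.
    rewrite -catA -flatC /=; apply: reduced_overlap => //.
    exact: (reduced_power i.+1 ct).
  congr word; rewrite vu -{1}(elt_word u) eu !elt_cat elt_winv elt_nseq.
  have conjV (x y : free_group r) : (y * (x * y^-1) = x ^ y^-1)%g.
    by rewrite conjgE invgK.
  by rewrite !conjV conjXg.
case: c {ru rct rtc eu} ev => [|a c] ev; first by rewrite cats0.
move: cv; rewrite ev winv_cons -!rcons_cat /cyclically_reduced /=.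
by rewrite rcons_path last_rcons no_cancel_linvl eqxx andbF.
Qed.

End Roots.

(** * Lines along periodic words *)

Section Lines.
Local Open Scope classical_set_scope.
Variables (r : nat).
Implicit Types (s t : seq (letter r)) (u v w : free_group r).
Implicit Types (R L f : nat -> letter r) (x y : tree_boundary r).

Lemma ray_exists_cat s R : (forall n, reduced (s ++ mkseq R n)) ->
  exists x, forall n, ray_word x (size s + n) = s ++ mkseq R n.
Proof.
move=> rsR; pose f n := if n < size s then nth (R 0) s n else R (n - size s).
have fE n : mkseq f (size s + n) = s ++ mkseq R n.
  rewrite mkseqD; congr (_ ++ _).
    rewrite -[RHS](mkseq_nth (R 0)); apply/eq_in_map => i.
    by rewrite mem_iota /f => /andP[_ ->].
  by apply: eq_mkseq => i; rewrite /f ltnNge leq_addr addKn.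
have [n|x xf] := @ray_exists r f; last by exists x => n; rewrite xf.
by have := rsR n; rewrite -fE addnC mkseqD => /reduced_catW[].
Qed.

(** The nonempty [t] ensures that nothing cancels between [s] and [R]. The bound [size s] makes the
    ray asymptotic to the path leaving [elt s] along [R]. *)
Lemma ray_through s t R : (forall n, no_cancel (R n) (R n.+1)) ->
  reduced (s ++ t) -> t != [::] -> t = mkseq R (size t) ->
  exists x, ray_word x (size (s ++ t)) = s ++ t /\
    forall i, tree_dist (set_val x i) (elt (s ++ mkseq R i)) <= size s.
Proof.
move=> Rr rst t0 et; have rR := reduced_mkseqP Rr.
have [n|x xR] := @ray_exists_cat s R.
  have : reduced (s ++ mkseq R (size t + n)).
    rewrite mkseqD -et; apply: reduced_overlap => //.
    by rewrite {1}et -mkseqD.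
  by rewrite addnC mkseqD catA => /reduced_catW[].
exists x; split; first by rewrite size_cat xR -et.
move=> i; rewrite -xR (elt_word (set_val x (size s + i))) ray_dist; lia.
Qed.

Section LineOfPeriodicWord.
Variables (a0 : letter r) (g : free_group r).
Hypotheses (g0 : word g != [::]) (cg : cyclically_reduced g).
Variables (c : nat).
Let p := size g.
(* [R] reads the periodic word forwards from position [c];
   [L] reads it backwards from there, inverted: [n.+1 * p.-1] is [- n.+1]
   modulo [p]. *)
Let P n := periodic_letter a0 g n.
Let R n := P (c + n).
Let L n := linv (P (c + n.+1 * p.-1)).

Let p0 : 0 < p. Proof. by rewrite /p lt0n size_eq0. Qed.

Let P_no_cancel n : no_cancel (P n) (P n.+1).
Proof. exact: periodic_no_cancel. Qed.

Let R_no_cancel n : no_cancel (R n) (R n.+1).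
Proof. by rewrite /R addnS P_no_cancel. Qed.

Let shiftE q : P (c + q.+1 * p.-1).+1 = P (c + q * p.-1).
Proof.
apply: eq_periodic; rewrite mulSn addnCA -addSn prednK //.
by rewrite -/p modnDl.
Qed.

Let L_no_cancel n : no_cancel (L n) (L n.+1).
Proof. by rewrite /L no_cancel_linv -(shiftE n.+1) P_no_cancel. Qed.

Let heads : R 0 != L 0.
Proof.
rewrite /R /L addn0; have := P_no_cancel (c + 1 * p.-1).
by rewrite shiftE // mul0n addn0.
Qed.

Lemma winv_mkseq_backward b n : b + n = c %[mod p] ->
  winv (mkseq L n) = mkseq (fun i => P (b + i)) n.
Proof.
move=> bn; apply: (@eq_from_nth _ a0) => [|i].
  by rewrite size_winv !size_mkseq.
rewrite size_winv size_mkseq => ltin.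
have lt_rev : n - i.+1 < n by move: ltin; clear; lia.
rewrite /winv nth_rev size_map size_mkseq //.
rewrite (nth_map a0) ?size_mkseq // !nth_mkseq ?linvK //.
apply: eq_periodic; rewrite -/p -modnDml -bn modnDml.
have -> : (n - i.+1).+1 = n - i by lia.
have -> : b + n + (n - i) * p.-1 = (n - i) * p + (b + i).
  rewrite -[p in RHS](prednK p0) mulnS -/p; move: (_ * p.-1) => k; lia.
by rewrite modnMDl.
Qed.

(** The vertex [elt s] sits at position [c] of the periodic word. The integer [Negz n] is [- n.+1],
    whence the length [n.+1]. *)
Definition line_of_periodic s (i : int) : free_group r :=
  match i with
  | Posz n => elt (s ++ mkseq R n)
  | Negz n => elt (s ++ mkseq L n.+1)
  end.

Let line_neg s n : line_of_periodic s (- n%:Z)%R = elt (s ++ mkseq L n).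
Proof. by case: n. Qed.

Let line_geodesic s : geodesic_line (line_of_periodic s).
Proof.
have RL m n : tree_dist (elt (s ++ mkseq R m)) (elt (s ++ mkseq L n)) = m + n.
  rewrite tree_dist_elt_cat reduce_id ?size_cat ?size_winv ?size_mkseq //.
  apply: reduced_winv_cat; [exact: reduced_mkseqP.. |].
  by case: m => // m; case: n => // n; rewrite /heads_differ /=.
case=> i [] j; rewrite /line_of_periodic.
- by rewrite tree_dist_mkseq //; exact: reduced_mkseqP.
- by rewrite RL; lia.
- by rewrite tree_distC RL; lia.
- by rewrite tree_dist_mkseq; [lia|exact: reduced_mkseqP].
Qed.

Let line_of_root s : is_line_of g (line_of_periodic s).
Proof.
split; first exact: line_geodesic.
(* This is the vertex at position [0] of the periodic word, so that [g ^+ j] leads to the parameter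
   [j * p - c] of the line. *)
exists (elt s * (elt (mkseq P c))^-1)%g => j.
have gj : (g ^+ j)%g = elt (mkseq P (j * p)).
  by rewrite /P mkseq_periodic_mul elt_nseq elt_word.
rewrite gj; split.
  case: (leqP c (j * p)) => cj.
    exists (Posz (j * p - c)) => //; rewrite /line_of_periodic elt_cat.
    by rewrite -[in RHS](subnKC cj) mkseqD elt_cat mulgA mulgVK.
  exists (- (c - j * p)%:Z)%R => //; rewrite line_neg elt_cat.
  have -> : mkseq P c =
      mkseq P (j * p) ++ mkseq (fun i => P (j * p + i)) (c - j * p).
    by rewrite -mkseqD subnKC // ltnW.
  rewrite [X in (_ * X^-1)%g]elt_cat invgM mulgA mulgVK; congr (_ * _)%g.
  rewrite -elt_winv; congr elt.
  by rewrite -[LHS]winvK (@winv_mkseq_backward (j * p)) // subnKC // ltnW.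
exists (- (j * p + c)%:Z)%R => //; rewrite line_neg elt_cat -mulgA;
  congr (_ * _)%g.
rewrite -invgM; have -> : (elt (mkseq P (j * p)) * elt (mkseq P c))%g
    = elt (mkseq P (j * p + c)).
  by rewrite /P mkseq_periodic_mul -elt_cat -mkseq_periodicD.
rewrite -elt_winv; congr elt.
by rewrite -[LHS]winvK (@winv_mkseq_backward 0) // add0n modnMDl.
Qed.

Lemma line_through s t t' :
  reduced (s ++ t) -> reduced (s ++ t') -> t != [::] -> t' != [::] ->
  t = mkseq L (size t) -> t' = mkseq R (size t') ->
  exists gamma x y, [/\ is_line_of g gamma, endpoints gamma y x,
    ray_word x (size (s ++ t)) = s ++ t &
    ray_word y (size (s ++ t')) = s ++ t'].
Proof.
move=> rt rt' t0 t'0 et et'.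
have [x [xt xL]] := ray_through L_no_cancel rt t0 et.
have [y [yt' yR]] := ray_through R_no_cancel rt' t'0 et'.
exists (line_of_periodic s), x, y; split => //.
by split; exists (size s) => i; rewrite ?line_neg.
Qed.

End LineOfPeriodicWord.

Lemma line_through_factor (g : free_group r) s t t' j :
  word g != [::] -> cyclically_reduced g ->
  reduced (s ++ t) -> reduced (s ++ t') -> t != [::] -> t' != [::] ->
  infix (winv t ++ t') (flatten (nseq j (word g))) ->
  exists gamma x y, [/\ is_line_of g gamma, endpoints gamma y x,
    ray_word x (size (s ++ t)) = s ++ t &
    ray_word y (size (s ++ t')) = s ++ t'].
Proof.
move=> g0 cg rt rt' t0 t'0 /infixP[l [l' e]].
have a0 : letter r by case: t t0 {rt e}.
pose m := size l; pose n := size t; pose n' := size t'.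
have sizes : j * size g = m + n + n' + size l'.
  rewrite -[LHS](size_mkseq (periodic_letter a0 g)) mkseq_periodic_mul e.
  by rewrite !size_cat size_winv !addnA.
have := mkseq_periodic_mul a0 g j; rewrite e sizes !mkseqD -!catA => /eqP.
rewrite eqseq_cat ?size_mkseq // => /andP[_].
rewrite eqseq_cat ?size_mkseq ?size_winv // => /andP[/eqP et].
rewrite eqseq_cat ?size_mkseq // => /andP[/eqP et' _].
(* The branches meet at position [m + n], where [winv t] ends and [t'] begins. *)
apply: (@line_through a0 g g0 cg (m + n)) => //.
rewrite -[LHS]winvK -et -(@winv_mkseq_backward a0 g g0 cg (m + n) m n) ?winvK
  //.
Qed.

End Lines.

Import GRing.Theory.

(** * Ends of axes *)

Section AxisEnds.
Local Open Scope classical_set_scope.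
Variable (r : nat).
Implicit Types (a b g h : free_group r) (x y z : tree_boundary r).

Lemma tree_dist_expg h g i j : cyclically_reduced g -> i <= j ->
  tree_dist (h * g ^+ i)%g (h * g ^+ j)%g = (j - i) * size g.
Proof.
move=> cg ij; rewrite tree_dist_mull -{1}(subnKC ij) expgnDr tree_dist_mulr.
by rewrite word_expg // size_flatten /shape map_nseq sumn_nseq mulnC.
Qed.

Lemma tree_dist_expgV h g i j : cyclically_reduced g ->
  tree_dist (h * g ^- i)%g (h * g ^+ j)%g = (i + j) * size g.
Proof.
move=> cg; have := tree_dist_expg 1%g cg (leq0n (i + j)).
rewrite subn0 !mul1g expg0 => <-; rewrite -(tree_dist_mull (g ^+ i * h^-1)%g).
by rewrite !mulgA !mulgVK mulgV -expgnDr.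
Qed.

(** [is_line_of] does not tell at which parameters the vertices [h * g ^+ j] occur. Their distances
    force an arithmetic progression of step [size g]; [a] is a conjugate of [g] or of its inverse,
    according to the direction of [gamma]. *)
Lemma line_positions g gamma : word g != [::] -> cyclically_reduced g ->
  is_line_of g gamma -> exists a h (p0 : int), forall j : nat,
    gamma (p0 + (j * size g)%:Z)%R = (a ^+ j * h)%g /\
    gamma (p0 - (j * size g)%:Z)%R = (a ^- j * h)%g.
Proof.
move=> g0 cg [geo [h hg]].
have [|pos posP] := @choice _ _ (fun j i => gamma i = (h * g ^+ j)%g).
  by move=> j; have [[i _ <-] _] := hg j; exists i.
have [|neg negP] := @choice _ _ (fun j i => gamma i = (h * g ^- j)%g).
  by move=> j; have [_ [i _ <-]] := hg j; exists i.
have s0 : 0 < size g by rewrite lt0n size_eq0.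
have pp i j : i <= j -> `|pos i - pos j|%N = (j - i) * size g.
  by move=> ij; rewrite -geo !posP tree_dist_expg.
have np i j : `|neg i - pos j|%N = (i + j) * size g.
  by rewrite -geo negP posP tree_dist_expgV.
have conj_expg (u : free_group r) j :
    (h * u ^+ j = (u ^ h^-1) ^+ j * h)%g /\
    (h * u ^- j = (u ^ h^-1) ^- j * h)%g.
  by rewrite -conjXg -conjVg !conjgE invgK !mulgA !mulgVK.
have pos01 := pp 0 1 isT; have pos0 j := pp 0 j (leq0n j).
have pos1 j := pp 1 j.+1 isT; have neg0 j := np j 0; have neg1 j := np j 1.
have [e|e] : pos 1 = (pos 0 + (size g)%:Z)%R \/ pos 1 = (pos 0 - (size g)%:Z)%R.
  by move: pos01; rewrite subn0 mul1n; move: (pos 0) (pos 1); lia.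
- exists (g ^ h^-1)%g, h, (pos 0) => j.
  have [<- <-] := conj_expg g j; rewrite -posP -negP.
  split; congr gamma; last first.
    move: (neg0 j) (neg1 j); rewrite e addn0 mulnDl mul1n.
    by move: (j * _) (pos 0) (neg j) s0 => J; lia.
  case: j => [|j]; first by rewrite mul0n addr0.
  move: (pos0 j.+1) (pos1 j); rewrite e subn0 subSS subn0 mulSn.
  by move: (j * _) (pos 0) (pos j.+1) s0 => J; lia.
- exists (g^-1 ^ h^-1)%g, h, (pos 0) => j.
  have [<- <-] := conj_expg g^-1%g j; rewrite !expVgn invgK -posP -negP.
  split; congr gamma.
    move: (neg0 j) (neg1 j); rewrite e addn0 mulnDl mul1n.
    by move: (j * _) (pos 0) (neg j) s0 => J; lia.
  case: j => [|j]; first by rewrite mul0n subr0.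
  move: (pos0 j.+1) (pos1 j); rewrite e subn0 subSS subn0 mulSn.
  by move: (j * _) (pos 0) (pos j.+1) s0 => J; lia.
Qed.

(* [x] and [y] are the attracting and the repelling fixed point of some [a]. *)
Definition axial x y := exists a p C, 0 < p /\ forall j,
  tree_dist (set_val x (j * p)) (a ^+ j)%g <= C /\
  tree_dist (set_val y (j * p)) (a ^- j)%g <= C.

Lemma axial_sym x y : axial x y -> axial y x.
Proof.
move=> [a [p [C [p0 aC]]]]; exists a^-1%g, p, C; split=> // j.
by rewrite !expVgn invgK; have [] := aC j.
Qed.

Lemma axial_line g gamma x y : word g != [::] -> cyclically_reduced g ->
  is_line_of g gamma -> endpoints gamma x y -> axial x y.
Proof.
move=> g0 cg lg [[C xC] [D yD]].
have [a [h [p0 hp]]] := line_positions g0 cg lg; have [geo _] := lg.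
(* [C] and [D] bound the distances between rays and line, [p0] is the shift of the parameter, and
   [size h] is the distance from [a ^+ j * h] to [a ^+ j]. *)
exists a, (size g), (C + D + `|p0|%N + size h); split.
  by rewrite lt0n size_eq0.
move=> j; have [pj nj] := hp j; set J := j * size g in pj nj *; split.
  apply: leq_trans (tree_dist_triangle _ (gamma J) _) _.
  apply: leq_trans (leq_add (xC J) (tree_dist_triangle _ (gamma (p0 + J%:Z)%R)
    _)) _.
  rewrite geo pj tree_distC tree_dist_mulr; lia.
apply: leq_trans (tree_dist_triangle _ (gamma (- J%:Z)%R) _) _.
apply: leq_trans (leq_add (yD J) (tree_dist_triangle _ (gamma (p0 - J%:Z)%R)
  _)) _.
rewrite geo nj tree_distC tree_dist_mulr; lia.
Qed.

(** Pigeonhole principle: there are finitely many words of length at most [C]. *)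
Lemma bounded_repeat (f : nat -> free_group r) C :
  (forall j, size (f j) <= C) ->
  exists i j, i < j /\ f i = f j.
Proof.
move=> fC; apply: contrapT => nex.
pose F (i : 'I_(#|{: C.-bseq (letter r)}|.+1)) : C.-bseq (letter r) :=
  Bseq (fC i).
suff /leq_card : injective F by rewrite card_ord ltnn.
move=> i j /(congr1 (@bseqval _ _)) /= fij; apply: val_inj.
have {}fij : f i = f j by exact: val_inj.
by case: (ltngtP i j) => // ij; case: nex; [exists i, j|exists j, i].
Qed.

(* If [a ^+ j] and [b ^+ j] follow the same ray, then some positive powers of
   [a] and [b] coincide, so that their negative powers follow the same ray. *)
Lemma axial_unique x y z : axial x y -> axial x z -> y = z.
Proof.
move=> [a [p [C [p0 aC]]]] [b [q [D [q0 bD]]]].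
(* With these exponents [a ^+ (j * q)] and [b ^+ (j * p)] are both close to the ray at time
   [j * p * q], so their quotient has bounded length. *)
have [|i [j [ij]]] := @bounded_repeat (fun j => a ^- (j * q) * b ^+ (j * p))%g
  (C + D).
  move=> j; rewrite -/(tree_dist _ _).
  apply: leq_trans (tree_dist_triangle _ (set_val x (j * q * p)) _) _.
  apply: leq_add; first by rewrite tree_distC; have [] := aC (j * q).
  by rewrite mulnAC; have [] := bD (j * p).
rewrite -(subnKC (ltnW ij)); set m := j - i => e.
(* Equal quotients at [i] and [i + m] give [a ^+ (m * q) = b ^+ (m * p)]. *)
have : (a ^+ ((i + m) * q) * (a ^- (i * q) * b ^+ (i * p)) =
    b ^+ ((i + m) * p))%g.
  by rewrite e mulVKg.
rewrite addnC !mulnDl !expgnDr -mulgA mulVKg => /mulIg ab.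
have m0 : 0 < m by rewrite /m subn_gt0.
apply: (@ray_dist_unbounded _ y z (m * p * q) (C + D)).
  by rewrite !muln_gt0 m0 p0.
move=> k; apply: leq_trans (tree_dist_triangle _ (a ^- (m * q * k))%g _) _.
apply: leq_add.
  have -> : k * (m * p * q) = m * q * k * p by lia.
  by have [] := aC (m * q * k).
have -> : k * (m * p * q) = m * p * k * q by lia.
rewrite expgnA ab -expgnA tree_distC.
by have [] := bD (m * p * k).
Qed.

End AxisEnds.

(** * Classes of identified points *)

Section JoinedClasses.
Local Open Scope classical_set_scope.
Variables (r : nat) (P : set (set (free_group r))).
Implicit Types (x y z : tree_boundary r).

Lemma root_neq1 (g : free_group r) : g != 1%g ->
  word (free_root (cyclic_reduction g)) != [::] /\
  cyclically_reduced (free_root (cyclic_reduction g)).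
Proof.
move=> g1; have c1 : cyclic_reduction g != 1%g.
  by apply: contra_neq g1 => /cyclic_reduction_eq1.
split; last first.
  by apply: cyclically_reduced_root => //; have [] := cyclic_reductionP g.
apply: contra_neq c1 => r0; have [[i _ ->] _] := free_rootP (cyclic_reduction
  g).
by rewrite (_ : free_root _ = 1%g) ?expg1n //; exact: val_inj.
Qed.

Lemma joined_axial x y : joined P x y -> axial x y.
Proof.
move=> [gamma [A [_ A1 _ [g Ag lg]]] xy].
have [|g0 cg] := @root_neq1 g; first by apply: contra_notN A1 => /eqP <-.
exact: axial_line g0 cg lg xy.
Qed.

(** Chains of joined points do not grow: by [axial_unique], two axial steps through a common point
    lead back to the start. *)
Lemma identified_axial x y : identified P x y -> x = y \/ axial x y.
Proof.
move=> /asboolP; elim=> {x y} [x y /joined_axial|x|x y _ [->|/axial_sym]|].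
- by right.
- by left.
- by left.
- by right.
move=> x y z _ [->|xy] _ [<-|yz]; [by left|by right|by right|left].
exact: axial_unique (axial_sym xy) yz.
Qed.

End JoinedClasses.

(** * Separations of the decomposition space *)

Lemma letter_avoiding r (a b : letter r) : 2 <= r -> exists c, c != a /\ c != b.
Proof.
move=> hr; apply: contrapT => nex.
have : #|letter r| <= #|pred2 a b|.
  apply: subset_leq_card; apply/fintype.subsetP => c _; rewrite !inE;
    apply: contrapT => /negP.
  by rewrite negb_or => /andP[ca cb]; apply: nex; exists c.
rewrite card2 card_prod card_ord card_bool; case: (a != b); lia.
Qed.

Section Colouring.
Local Open Scope classical_set_scope.
Variables (r k : nat) (P : set (set (free_group r))).
Hypotheses (hr : 2 <= r) (hk : 0 < k).
Implicit Types (a b c : letter r) (s t : seq (letter r)).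
Implicit Types (x y z : tree_boundary r).

(** The path from [elt (s ++ t)] to [elt (s ++ t')] turns at [elt s]; it is to be extended beyond
    both of its ends by a peripheral line. *)
Definition joins_short_paths := forall s t t',
  reduced (s ++ t) -> reduced (s ++ t') -> t != [::] -> t' != [::] ->
  heads_differ t t' -> size t + size t' <= 4 * k ->
  exists x y, [/\ joined P y x, ray_word x (size (s ++ t)) = s ++ t &
    ray_word y (size (s ++ t')) = s ++ t'].

(* [bad] is to be the preimage of the removed points, and [col] tells on which
   side of a separation of the other points a point lies. *)
Variables (bad : set (tree_boundary r)) (T : seq (tree_boundary r)).
Variable (col : tree_boundary r -> bool).
Hypotheses (hP : joins_short_paths)
  (badT : forall x, bad x -> x \in T) (sizeT : (size T).+1 < 2 * k)
  (col_joined : forall x y, joined P y x -> col x = col y)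
  (col_local : forall x, ~ bad x -> exists n, forall y, ~ bad y ->
     ray_word y n = ray_word x n -> col x = col y).

Definition cylinder s : set (tree_boundary r) :=
  [set x | ray_word x (size s) = s].

Lemma cylinder_take s n x : cylinder s x -> cylinder (take n s) x.
Proof.
rewrite /cylinder /= => xs; rewrite -[in RHS]xs size_take_min.
case: (leqP n (size s)) => [ns|/ltnW ns]; first by rewrite take_ray_word.
by rewrite take_oversize // size_ray_word.
Qed.

Lemma cylinder_catl s t x : cylinder (s ++ t) x -> cylinder s x.
Proof. by move=> /(@cylinder_take _ (size s)); rewrite take_size_cat. Qed.

Lemma cylinder_nonempty s : reduced s -> s != [::] -> cylinder s !=set0.
Proof.
case/lastP: s => // s a rs _; rewrite -cats1.
have [|||//|x [xs _]] := @ray_through r s [:: a] (fun=> a) => //.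
- by move=> _; exact: no_cancel_refl.
- by rewrite cats1.
- by exists x.
Qed.

Definition free_of s := forall x, cylinder s x -> ~ bad x.

(** In particular, [same_colour s s] means that the cylinder of [s] is monochromatic. *)
Definition same_colour s t := forall x y, cylinder s x -> cylinder t y ->
  col x = col y.

Lemma same_colour_fork s t t' :
  reduced (s ++ t) -> reduced (s ++ t') -> t != [::] -> t' != [::] ->
  heads_differ t t' -> size t + size t' <= 4 * k ->
  same_colour (s ++ t) (s ++ t) -> same_colour (s ++ t') (s ++ t') ->
  same_colour (s ++ t) (s ++ t').
Proof.
move=> rt rt' t0 t'0 tt' le4 mt mt' x y xt yt'.
have [x' [y' [j xt' yt]]] := hP rt rt' t0 t'0 tt' le4.
by rewrite (mt _ _ xt xt') (col_joined j) (mt' _ _ yt yt').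
Qed.

(* Otherwise one descends forever through children that are not monochromatic,
   towards a point around which the colour is not locally constant. *)
Lemma free_monochromatic s : reduced s -> s != [::] -> free_of s ->
  same_colour s s.
Proof.
move=> rs s0 fs; apply: contrapT => ms.
have a0 : letter r by case: s s0 {rs fs ms}.
(* A letter is provided for every word, the default [a0] if [u] is no candidate, so that [choice]
   yields a function. *)
have next u : exists a, reduced u -> u != [::] -> ~ same_colour u u ->
    reduced (rcons u a) /\ ~ same_colour (rcons u a) (rcons u a).
  have [[ru u0 mu]|nu] := pselect [/\ reduced u, u != [::] & ~ same_colour u u];
    last by exists a0 => ru u0 mu; case: nu.
  apply: contrapT => nex; apply: mu => x y xu yu.
  have child z : cylinder u z -> exists a, cylinder (u ++ [:: a]) z /\
      reduced (u ++ [:: a]).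
    move=> zu; pose W := ray_word z (size u).+1.
    have eW : W = u ++ [:: nth a0 W (size u)].
      rewrite cats1 -[X in rcons X _]zu -(take_ray_word z (leqnSn _)).
      by rewrite -take_nth ?take_oversize ?size_ray_word.
    exists (nth a0 W (size u)); rewrite -eW.
    by split; [rewrite /cylinder /= size_ray_word|exact: reduced_ray_word].
  have mono a : reduced (u ++ [:: a]) ->
      same_colour (u ++ [:: a]) (u ++ [:: a]).
    rewrite cats1 => ra; apply: contrapT => ma; apply: nex.
    by exists a => _ _ _; split.
  have [a [xa ra]] := child x xu; have [b [yb rb]] := child y yu.
  (* Distinct children are one letter off [u], so a line connects them; if all of them were
     monochromatic, [u] would be too. *)
  case: (eqVneq a b) => [ab|ab]; first by apply: (mono a ra) => //; rewrite ab.
  apply: (same_colour_fork ra rb _ _ _ _ (mono a ra) (mono b rb)) => //=; lia.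
have [nxt nxtP] := choice next.
pose F := fix F n := if n is n'.+1 then rcons (F n') (nxt (F n')) else s.
have FE n : F n = s ++ mkseq (fun i => nxt (F i)) n.
  by elim: n => [|n IH]; rewrite ?cats0 // mkseqS -rcons_cat -IH.
have FP n : [/\ reduced (F n), F n != [::] & ~ same_colour (F n) (F n)].
  elim: n => [//|n [rF F0 mF]] /=; have [rF' mF'] := nxtP _ rF F0 mF.
  by split=> //; case: (F n).
(* The limit of the descent lies in the cylinder of [s], hence is not bad, and the colour is
   constant near it. *)
have [n|x xF] := @ray_exists_cat r s (fun i => nxt (F i)).
  by rewrite -FE; have [] := FP n.
have xs : cylinder s x by rewrite /cylinder /= -{1}(addn0 (size s)) xF cats0.
have [n nP] := col_local (fs _ xs).
have [_ _ []] := FP n.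
have near y : cylinder (F n) y -> col x = col y.
  move=> yF; apply: nP; first by apply: fs; move: yF; rewrite FE;
    exact: cylinder_catl.
  have sF : size (F n) = size s + n by rewrite FE size_cat size_mkseq.
  rewrite -!(@take_ray_word _ _ n (size s + n)) ?leq_addl //.
  by rewrite xF -FE -sF yF.
by move=> y z yF zF; rewrite -(near y yF) -(near z zF).
Qed.

(* The sides of the last [2k] edges towards [s] are disjoint, and there are more
   of them than points to be avoided. *)
Lemma free_side s : reduced s -> 2 * k < size s -> exists i a,
  [/\ size s - 2 * k <= i, i.+1 < size s, a != nth a s i,
      reduced (take i s ++ [:: a]) & free_of (take i s ++ [:: a])].
Proof.
move=> rs ks; apply: contrapT => nex.
have a0 : letter r by case: s ks {rs nex}.
(* The [2k - 1] branching positions run from [size s - 2k] to [size s - 2], while [T] has at most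
   [2k - 2] points. *)
pose q (i : 'I_(2 * k).-1) := size s - 2 * k + i.
have qs i : (q i).+1 < size s by have := ltn_ord i; rewrite /q; lia.
have side (i : 'I_(2 * k).-1) : exists x,
    bad x /\ exists2 a, a != nth a0 s (q i) &
    ray_word x (q i).+1 = rcons (take (q i) s) a.
  (* Unlike the next letter of [s], [a] leaves [s]; unlike the inverse of the previous one, it keeps
     the word reduced. *)
  have [a [aq al]] := letter_avoiding (nth a0 s (q i))
    (linv (nth a0 s (q i).-1)) hr.
  apply: contrapT => nbad; apply: nex; exists (q i), a.
  have qi0 : 0 < q i by rewrite /q; lia.
  have st : size (take (q i) s ++ [:: a]) = (q i).+1.
    by rewrite cats1 size_rcons size_take (ltn_trans _ (qs i)).
  split => //; first by rewrite /q; lia.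
  - by rewrite (set_nth_default a0) // (ltn_trans _ (qs i)).
  - rewrite cats1 -(prednK qi0) (take_nth a0) ?reduced_rcons2;
    last by move: (qs i); lia.
    rewrite -take_nth; last by move: (qs i); lia.
    rewrite /no_cancel al andbT; exact: take_sorted.
  - move=> x xa xbad; apply: nbad; exists x; split=> //; exists a => //.
    by move: xa; rewrite /cylinder /= st cats1.
have [f fP] := choice side.
suff injf : injective f.
  have : size (map f (enum 'I_(2 * k).-1)) <= size T.
    apply: uniq_leq_size; first by rewrite map_inj_uniq ?enum_uniq.
    by move=> _ /mapP[i _ ->]; apply: badT; have [] := fP i.
  rewrite size_map size_enum_ord; lia.
(* The point [f j] still follows [s] where [f i] leaves it. *)
have lt_neq (i j : 'I_(2 * k).-1) : i < j -> f i <> f j.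
  move=> ij fij; have [_ [a /eqP ai xa]] := fP i; have [_ [b _ xb]] := fP j.
  have qij : (q i).+1 <= q j by rewrite /q; lia.
  apply: ai; have := congr1 (last a0) xa; rewrite last_rcons => <-.
  rewrite fij -(take_ray_word _ (leqW qij)) xb -cats1 takel_cat; last first.
    by rewrite size_take; case: ifP => _; [|apply: ltnW; exact: qs].
  by rewrite take_takel // (take_nth a0) ?last_rcons // ltnW.
move=> i j fij; apply: val_inj; case: (ltngtP i j) => // ij.
  by case: (lt_neq _ _ ij).
by case: (lt_neq _ _ ij).
Qed.

(** A free branch given by [free_side] is shorter than [s]. What remains of [s] after the branching
    has at most [2 * k] letters and the branch has one, so a line connects the two cylinders. *)
Lemma free_climb s : reduced s -> s != [::] -> free_of s -> exists t,
  [/\ reduced t, t != [::], free_of t, size t <= 2 * k & same_colour s t].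
Proof.
have [n] := ubnP (size s); elim: n s => // n IH s le_n rs s0 fs.
case: (leqP (size s) (2 * k)) => [ks|ks].
  by exists s; split=> //; exact: free_monochromatic.
have [i [a [ki lti ai ra fa]]] := free_side rs ks.
have f0 : take i s ++ [:: a] != [::] by case: (take i s).
have sf : size (take i s ++ [:: a]) = i.+1.
  by rewrite cats1 size_rcons size_take (ltn_trans _ lti).
have [|t [rt t0 ft kt st]] := IH _ _ ra f0 fa.
  by rewrite sf; apply: leq_trans lti _.
exists t; split=> // x y xs yt.
have [z za] := cylinder_nonempty ra f0.
rewrite -(st z y za yt); move: xs; rewrite -{1}(cat_take_drop i s) => xs.
apply: (same_colour_fork _ ra _ _ _ _ _ _ xs za) => //;
  rewrite ?cat_take_drop //.
- by rewrite -size_eq0 size_drop subn_eq0 -ltnNge (ltn_trans _ lti).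
- by rewrite (drop_nth a) /= ?(ltn_trans _ lti) // eq_sym.
- by rewrite size_drop addn1; move: (size s) ki ks hk => l; clear; lia.
- exact: free_monochromatic.
- exact: free_monochromatic.
Qed.

(** After climbing, both words have at most [2 * k] letters. Either their cylinders are nested, or
    the path between the words has at most [4 * k] edges; this is where the bound in
    [joins_short_paths] comes from. *)
Lemma free_same_colour s t : reduced s -> s != [::] -> free_of s ->
  reduced t -> t != [::] -> free_of t -> same_colour s t.
Proof.
move=> rs s0 fs rt t0 ft x y xs yt.
have [s' [rs' s'0 fs' ks' ss']] := free_climb rs s0 fs.
have [t' [rt' t'0 ft' kt' tt']] := free_climb rt t0 ft.
have [x' xs'] := cylinder_nonempty rs' s'0.
have [y' yt'] := cylinder_nonempty rt' t'0.
rewrite (ss' x x' xs xs') (tt' y y' yt yt') => {x y xs yt ss' tt'}.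
have ms := free_monochromatic rs' s'0 fs'.
have mt := free_monochromatic rt' t'0 ft'.
have [z [u [v [es et uv]]]] := split_lcp s' t'.
case: (eqVneq u [::]) => [u0|u0].
  by apply: ms => //; rewrite es u0 cats0; apply: (@cylinder_catl _ v);
    rewrite -et.
case: (eqVneq v [::]) => [v0|v0].
  by apply: mt => //; rewrite et v0 cats0; apply: (@cylinder_catl _ u);
    rewrite -es.
rewrite es in rs' ks' xs' ms; rewrite et in rt' kt' yt' mt.
apply: (same_colour_fork rs' rt' _ _ _ _ ms mt) => //.
by move: ks' kt'; rewrite !size_cat; lia.
Qed.

(** As [T] is finite, a long initial segment of [x] separates it from all bad points. *)
Lemma free_prefix x : ~ bad x -> exists2 n, 0 < n & free_of (ray_word x n).
Proof.
move=> bx.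
have [n nP] : exists n, forall z, z \in T -> bad z -> forall m, n <= m ->
    ray_word z m <> ray_word x m.
  elim: (T) => [|z T' [n IH]]; first by exists 0.
  have [bz|bz] := pselect (bad z); last first.
    by exists n => y; rewrite inE => /orP[/eqP -> //|]; exact: IH.
  have [i zx] : exists i, ray_word z i <> ray_word x i.
    apply: contrapT => nex; apply: bx; rewrite -(_ : z = x) //.
    by apply: ray_word_inj => i; apply: contrapT => zx; apply: nex; exists i.
  exists (maxn n i) => y; rewrite inE => /orP[/eqP -> _|yT' yb] m; last first.
    by rewrite geq_max => /andP[nm _]; exact: IH.
  rewrite geq_max => /andP[_ im] /(congr1 (take i)).
  by rewrite !take_ray_word.
exists n.+1 => // z; rewrite /cylinder /= size_ray_word => zx bz.
by apply: (nP z (badT bz) bz n.+1).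
Qed.

Lemma monochromatic x y : ~ bad x -> ~ bad y -> col x = col y.
Proof.
move=> /free_prefix[m m0 fx] /free_prefix[n n0 fy].
apply: (free_same_colour _ _ fx _ _ fy); rewrite ?reduced_ray_word //.
- by rewrite -size_eq0 size_ray_word -lt0n.
- by rewrite -size_eq0 size_ray_word -lt0n.
- by rewrite /cylinder /= size_ray_word.
- by rewrite /cylinder /= size_ray_word.
Qed.

End Colouring.

(** * Connectedness of the decomposition space *)

Section Boundary.
Local Open Scope classical_set_scope.
Variables (r k : nat) (P : set (set (free_group r))).
Hypotheses (hr : 2 <= r) (hk : 0 < k) (hP : joins_short_paths k P).
Implicit Types (x y z : tree_boundary r).

Let piB (x : tree_boundary r) : bowditch_boundary P :=
  (\pi_(bowditch_boundary P) x)%qT.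

Lemma pi_boundary_eq x y : piB x = piB y <-> identified P x y.
Proof.
split; first by move=> /eqmodP.
by move=> xy; apply/eqmodP.
Qed.

Lemma pi_boundaryK c : piB (repr c) = c.
Proof. exact: reprK. Qed.

Lemma boundary_nbhs_pi (C : set (bowditch_boundary P)) x :
  open C -> C (piB x) ->
  exists n, forall y, ray_word y n = ray_word x n -> C (piB y).
Proof. by move=> oC Cx; apply: (@boundary_nbhs r x (piB @^-1` C)). Qed.

(** The default [x] is taken when the class of [x] is a single point. *)
Definition partner x : tree_boundary r :=
  xget x [set y | y <> x /\ identified P x y].

Lemma in_class x y : piB y = piB x -> y = x \/ y = partner x.
Proof.
move=> yx; have [->|ne] := pselect (y = x); [by left|right].
have xy : identified P x y by apply/pi_boundary_eq.
have [px ixp] : [set y | y <> x /\ identified P x y] (partner x).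
  by apply: (xgetPex x); exists y.
have [e|axy] := identified_axial xy; first by case: ne.
have [e|axp] := identified_axial ixp; first by case: px.
exact: axial_unique axy axp.
Qed.

(** Membership in a relatively open and closed subset [B] is the colour: it is locally constant on
    [B] by openness and off [B] by closedness. A single colour means that a nonempty [B] is
    everything. *)
Lemma connected_setC_small (S : set (bowditch_boundary P)) j :
  (S #= `I_j)%card -> j < k -> connected (~` S).
Proof.
move=> Sj jk; have finS : finite_set S by apply/finite_setP; exists j.
pose cs := finmap.enum_fset (fset_set S).
have size_cs : size cs = j by exact: card_fset_set.
have csP c : S c -> c \in cs by move=> Sc; rewrite in_fset_set // inE.
(* A class contains at most its representative and the partner of that, whence at most [2 * j] bad
   points. *)
pose T := map repr cs ++ map (partner \o repr) cs.
have badT x : S (piB x) -> x \in T.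
  move=> /csP xs; rewrite mem_cat.
  have [|e|e] := @in_class (repr (piB x)) x.
  - by rewrite pi_boundaryK.
  - by rewrite e map_f.
  - by apply/orP; right; apply/mapP; exists (piB x).
have sizeT : (size T).+1 < 2 * k by rewrite size_cat !size_map size_cs; lia.
move=> B [b0 Bb0] [C oC BC] [D cD BD].
pose col x := `[< B (piB x) >].
have colJ x y : joined P y x -> col x = col y.
  move=> yx; rewrite /col; congr asbool; congr B; apply/pi_boundary_eq.
  by rewrite identified_sym; apply/asboolP; exact: Relation_Operators.rst_step.
have colL x : ~ S (piB x) -> exists n, forall y, ~ S (piB y) ->
    ray_word y n = ray_word x n -> col x = col y.
  move=> Sx; have [Bx|Bx] := pselect (B (piB x)).
    have [_ Cx] : (~` S `&` C) (piB x) by rewrite -BC.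
    have [n nC] := boundary_nbhs_pi oC Cx; exists n => y Sy /nC Cy.
    by rewrite /col !asboolT // BC; split.
  have Dx : (~` D) (piB x) by move=> Dx; apply: Bx; rewrite BD; split.
  have [n nD] := boundary_nbhs_pi (closed_openC cD) Dx; exists n => y Sy /nD Dy.
  by rewrite /col !asboolF // BD => -[].
have colE := monochromatic hr hk hP badT sizeT colJ colL.
rewrite eqEsubset; split; first by rewrite BC; exact: subIsetl.
move=> c Sc; have Sb0 : (~` S) b0 by move: Bb0; rewrite BC => -[].
have := colE (repr c) (repr b0); rewrite !pi_boundaryK /col !pi_boundaryK.
move=> /(_ Sc Sb0); rewrite (asboolT Bb0) => /asboolP; exact.
Qed.

Lemma connected_of_joins_short_paths :
  connected_without_small_cut_set (bowditch_boundary P) k.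
Proof.
split=> [|S j [_ nS] Sj]; last by rewrite leqNgt;
  apply/negP => /(connected_setC_small Sj).
(* Connectedness is the case where nothing is removed, as [0 < k]. *)
rewrite -setC0; apply: (@connected_setC_small _ 0) => //.
by rewrite II0 card_eq0.
Qed.

End Boundary.

(** * Words containing all short words *)

Section FullWords.
Local Open Scope classical_set_scope.
Variables (r : nat).
Implicit Types (a b c : letter r) (s t : seq (letter r)) (g w : free_group r).

(** Each side of the joint forbids a single letter, and there are at least four. *)
Lemma reduced_connect s t : 2 <= r -> reduced s -> reduced t ->
  exists c, reduced (s ++ c :: t).
Proof.
move=> hr rs rt; case/lastP: s rs => [|s a] rs.
  case: t rt => [|b t] rt.
    pose b := (Ordinal (ltnW hr), true).
    by have [c _] := letter_avoiding b b hr; exists c.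
  have [c [cb _]] := letter_avoiding (linv b) (linv b) hr; exists c => /=.
  by move: rt; rewrite /reduced /= -/(no_cancel b c) no_cancelC in cb *;
    move=> ->; rewrite cb.
case: t rt => [|b t] rt.
  have [c [ca _]] := letter_avoiding (linv a) (linv a) hr; exists c.
  by rewrite reduced_rcons_cat_cons rs /no_cancel ca.
have [c [ca cb]] := letter_avoiding (linv a) (linv b) hr; exists c.
rewrite reduced_rcons_cat_cons rs /no_cancel ca /=.
by move: rt; rewrite /reduced /= => ->; rewrite no_cancelC /no_cancel cb.
Qed.

(** Such a word arises by concatenating all reduced words of length at most [m], separated by
    connecting letters. *)
Lemma universal_word m : 2 <= r -> exists2 u, reduced u &
  forall s, reduced s -> size s <= m -> infix s u.
Proof.
move=> hr; suff [u ru uP] : exists2 u : seq (letter r), reduced u &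
    forall s, s \in map val (enum {: m.-bseq (letter r)}) ->
      reduced s -> infix s u.
  exists u => // s rs sm; apply: uP => //.
  by apply/mapP; exists (Bseq sm); rewrite ?mem_enum.
elim: (map _ _) => [|s l [u ru IH]]; first by exists [::].
have [rs|nrs] := boolP (reduced s); last first.
  exists u => // s'; rewrite inE => /orP[/eqP -> rs|]; last exact: IH.
  by rewrite rs in nrs.
have [c rc] := reduced_connect hr rs ru; exists (s ++ c :: u) => // s'.
rewrite inE => /orP[/eqP -> _|sl rs']; first exact: prefixW (prefix_prefix _ _).
apply: infix_trans (IH _ sl rs') _; rewrite -cat_rcons.
exact: suffixW (suffix_suffix _ _).
Qed.

Definition full m g := forall s, reduced s -> size s <= m ->
  exists j, infix s (flatten (nseq j (word g))).

Lemma full_root_of_infix m u g :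
  (forall s, reduced s -> size s <= m -> infix s u) -> g != 1%g ->
  infix u (cyclic_reduction g) -> full m (free_root (cyclic_reduction g)).
Proof.
move=> uP g1 ug s rs sm; have [_ cr] := root_neq1 g1.
have [[i _ e] _] := free_rootP (cyclic_reduction g); exists i.
by rewrite -word_expg // -e; exact: infix_trans (uP s rs sm) ug.
Qed.

Lemma joins_short_paths_of_full k (A : set (free_group r)) g :
  finite_set A -> ~ A 1%g -> A g ->
  full (4 * k) (free_root (cyclic_reduction g)) ->
  joins_short_paths k (induced_peripheral_structure A).
Proof.
move=> fA A1 Ag fg s t t' rt rt' t0 t'0 tt' le4.
have [g0 cg] : word (free_root (cyclic_reduction g)) != [::] /\
    cyclically_reduced (free_root (cyclic_reduction g)).
  by apply: root_neq1; apply: contra_notN A1 => /eqP <-.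
have [] := fg (winv t ++ t').
- apply: reduced_winv_cat => //.
    by have [] := reduced_catW rt.
  by have [] := reduced_catW rt'.
- by rewrite size_cat size_winv.
move=> j /(line_through_factor g0 cg rt rt' t0 t'0)[gamma [x [y [lg e xt yt]]]].
by exists x, y; split=> //; exists gamma => //; exists A; split => //; exists g.
Qed.

(* The conjugating word cancelled by cyclic reduction has at most [n] letters
   unless the first [n] letters mirror the last ones. *)
Lemma infix_cyclic_reduction w n : 2 * n <= size w ->
  winv (take n w) != drop (size w - n) w ->
  infix (drop n (take (size w - n) w)) (cyclic_reduction w).
Proof.
move=> nw; have [_ [u ew]] := cyclic_reductionP w.
have sw : size w = size u + size (cyclic_reduction w) + size u.
  by rewrite {1}ew !size_cat size_winv addnA.
case: (leqP n (size u)) => [nu|/ltnW un].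
  have e : word w = (take n u ++ drop n u ++ cyclic_reduction w ++
      winv (drop n u)) ++ winv (take n u).
    by rewrite -!catA -winv_cat cat_take_drop catA cat_take_drop -ew.
  have stu : size (take n u) = n by rewrite size_takel.
  have tw : take n w = take n u by rewrite {1}ew takel_cat.
  have sn := congr1 size e; rewrite size_cat size_winv stu in sn.
  by rewrite tw sn addnK e drop_size_cat ?eqxx.
move=> _.
have -> : size w - n = size u + (size (cyclic_reduction w) - (n - size u)).
  by move: nw; rewrite sw; lia.
rewrite {1}ew take_cat ltnNge leq_addr addKn takel_cat ?leq_subr //.
rewrite drop_cat ltnNge un /=.
exact: infix_trans (infix_drop _ _) (infix_take _ _).
Qed.

End FullWords.

(** * Counting words *)

Section Counting.
Variables (r : nat).
Hypothesis hr : 2 <= r.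
Implicit Types (a b c : letter r) (s t u w : seq (letter r)).
Implicit Types (F G : seq (letter r) -> nat).

(** Predicates are coerced to [nat], so that the sum also counts words; keeping the prefix [s]
    allows counting block by block through [extension_sumD]. *)
Definition extension_sum n F s :=
  \sum_(w : n.-tuple (letter r) | reduced (s ++ w)) F (s ++ w).

Lemma extension_sum_eq0 n F s : ~~ reduced s -> extension_sum n F s = 0.
Proof.
move=> nrs; rewrite /extension_sum big_pred0 // => w; apply: contraNF nrs.
by case/reduced_catW.
Qed.

Lemma extension_sum0 F s : reduced s -> extension_sum 0 F s = F s.
Proof.
move=> rs; rewrite /extension_sum (big_pred1 [tuple]) ?cats0 // => w.
by rewrite tuple0 /= cats0 rs eqxx.
Qed.

Lemma extension_sumS n F s :
  extension_sum n.+1 F s = \sum_(a : letter r) extension_sum n F (rcons s a).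
Proof.
rewrite /extension_sum pair_big_dep /=.
rewrite (reindex (fun p : letter r * n.-tuple (letter r) => [tuple of p.1 ::
  p.2])) /=.
  by apply: eq_big => [[a w]|[a w] _]; rewrite /= cat_rcons.
exists (fun w : n.+1.-tuple _ => (thead w, [tuple of behead w])).
  by move=> [a w] _ /=; congr pair; apply: val_inj.
by move=> w _ /=; rewrite [RHS]tuple_eta.
Qed.

Lemma extension_sumD m n F s :
  extension_sum (m + n) F s = extension_sum m (extension_sum n F) s.
Proof.
elim: m s => [|m IH] s.
  have [rs|nrs] := boolP (reduced s); first by rewrite extension_sum0.
  by rewrite !extension_sum_eq0.
by rewrite addSn !extension_sumS; apply: eq_bigr => a _; exact: IH.
Qed.

Lemma leq_extension_sum n F G s :
  (forall w, reduced w -> size w = size s + n -> F w <= G w) ->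
  extension_sum n F s <= extension_sum n G s.
Proof.
by move=> FG; apply: leq_sum => w rw; apply: FG; rewrite ?size_cat ?size_tuple.
Qed.

Lemma extension_sumMr n F m s :
  extension_sum n (fun w => F w * m) s = extension_sum n F s * m.
Proof. by rewrite /extension_sum big_distrl. Qed.

Lemma extension_sum_le1 n (Q : pred (seq (letter r))) s :
  (forall w w', size w = n -> size w' = n ->
     Q (s ++ w) -> Q (s ++ w') -> w = w') ->
  extension_sum n Q s <= 1.
Proof.
move=> Q1; rewrite /extension_sum.
rewrite (eq_bigr (fun w : n.-tuple _ => if Q (s ++ w) then 1 else 0)) => [|w _];
  last by case: (Q _).
rewrite -big_mkcondr sum1_card; apply/card_le1_eqP => w w'.
move=> /andP[_ Qw] /andP[_ Qw']; apply: val_inj.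
by apply: Q1; rewrite ?size_tuple.
Qed.

(** The number of letters that may follow a given letter. *)
Definition branching := (2 * r).-1.

Lemma branching_gt1 : 1 < branching.
Proof. by rewrite /branching; lia. Qed.

Lemma extension_sum1 n s : reduced s -> s != [::] ->
  extension_sum n (fun=> 1) s = branching ^ n.
Proof.
elim: n s => [|n IH] s rs s0; first by rewrite extension_sum0.
rewrite extension_sumS (bigID (fun a => reduced (rcons s a))) /=.
rewrite [X in _ + X]big1 => [|a na]; last exact: extension_sum_eq0.
rewrite (eq_bigr (fun=> branching ^ n)) => [|a ra]; last first.
  by apply: IH => //; case: (s).
rewrite sum_nat_const addn0 expnS; congr (_ * _).
case/lastP: s rs s0 => // s b rs _.
rewrite (@eq_card _ _ (predC1 (linv b))) => [|a]; last first.
  by rewrite !inE unfold_in; have := reduced_rcons2 s b a; rewrite rs.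
by rewrite cardC1 card_prod card_ord card_bool mulnC.
Qed.

Definition words_count n := extension_sum n (fun=> 1) [::].

(** The condition [0 < m] is due to the first letter, which has [2 * r] choices. *)
Lemma words_countD m n : 0 < m ->
  words_count (m + n) = words_count m * branching ^ n.
Proof.
move=> m0; rewrite /words_count extension_sumD -extension_sumMr.
apply: eq_bigr => w rw; rewrite mul1n; apply: extension_sum1 => //.
by rewrite -size_eq0 size_tuple -lt0n.
Qed.

Lemma drop_cat_leq (T : Type) n (s t : seq T) : n <= size s ->
  drop n (s ++ t) = drop n s ++ t.
Proof.
rewrite drop_cat leq_eqVlt => /orP[/eqP ->|->] //.
by rewrite ltnn subnn drop0 drop_size.
Qed.

Lemma geometric_dominates x m : exists j0, forall j, j0 <= j ->
  m * x ^ j <= x.+1 ^ j.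
Proof.
case: x => [|x]; first by exists 1 => -[|j] // _; rewrite exp0n // muln0.
(* Bernoulli's inequality for [(1 + 1/X)^j] with [X = x.+1], cleared of denominators. *)
have bernoulli j : x.+1 ^ j * (x.+1 + j) <= x.+1 * x.+2 ^ j.
  elim: j => [|j IH]; first by rewrite addn0 mul1n muln1.
  rewrite !expnS; have := leq_mul (leqnn x.+2) IH.
  by move: (_ ^ _) (_ ^ _) => A B; nia.
exists (m * x.+1) => j mj; rewrite -(leq_pmul2l (ltn0Sn x)).
apply: leq_trans (bernoulli j); rewrite mulnA mulnC leq_mul2l mulnC.
by apply/orP; right; lia.
Qed.

(** * Words avoiding a factor *)

Section Avoiding.
Variables (u : seq (letter r)) (t : nat).
Hypothesis ru : reduced u.
Let L := (size u).+1.

Definition avoids (w : seq (letter r)) := ~~ infix u (drop t w).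

Lemma avoids_catl w w' : t <= size w -> avoids (w ++ w') -> avoids w.
Proof.
move=> tw; apply: contra => uw; rewrite drop_cat_leq //.
exact: infix_trans uw (prefix_infix _ _).
Qed.

Lemma extension_sum_avoids n s : reduced s -> s != [::] -> t <= size s ->
  extension_sum n avoids s <= avoids s * branching ^ n.
Proof.
move=> rs s0 ts; rewrite -(extension_sum1 n rs s0) mulnC -extension_sumMr.
apply: leq_sum => w _; rewrite mul1n; have := @avoids_catl s w ts.
by case: (avoids (s ++ w)) => // ->.
Qed.

(** At least one of the [branching ^ L] extensions contains [u]: a connecting letter followed by
    [u], whence the choice of [L]. *)
Lemma extension_sum_avoids_lt s : reduced s -> s != [::] -> t <= size s ->
  extension_sum L avoids s <= avoids s * (branching ^ L).-1.
Proof.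
move=> rs s0 ts; case as_: (avoids s); last first.
  by have := extension_sum_avoids L rs s0 ts; rewrite as_.
have [c rc] := reduced_connect hr rs ru;
  rewrite mul1n -(extension_sum1 L rs s0).
pose w0 := [tuple of c :: in_tuple u].
rewrite /extension_sum !(bigD1 (P := fun w : L.-tuple _ => reduced (s ++ w))
  w0) //=.
have -> : avoids (s ++ c :: u) = false.
  apply/negbF; rewrite drop_cat_leq // -cat_rcons.
  exact: suffix_infix.
by apply: leq_sum => w _; case: (avoids _).
Qed.

(** Every block of [L] letters loses an extension. The initial [t.+1] letters form a nonempty prefix
    that covers the dropped part. *)
Lemma avoids_decay j :
  extension_sum (t.+1 + j * L) avoids [::] <=
    words_count t.+1 * (branching ^ L).-1 ^ j.
Proof.
elim: j => [|j IH].
  by rewrite addn0 muln1; apply: leq_extension_sum => w _ _; case: (avoids w).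
rewrite mulSnr addnA extension_sumD expnSr mulnA.
apply: leq_trans (leq_mul IH (leqnn _)); rewrite -extension_sumMr.
apply: leq_extension_sum => w rw; rewrite add0n => sw.
by apply: extension_sum_avoids_lt; rewrite -?size_eq0 ?sw // addSn ltnW //
  leq_addr.
Qed.

(** The proportion is at most the [j]-th power of a constant below [1], where [j] counts complete
    blocks; the [i] letters left over do not raise it. *)
Lemma avoids_negligible m : exists n0, forall n, n0 <= n ->
  m * extension_sum n avoids [::] <= words_count n.
Proof.
have [j0 j0P] := geometric_dominates (branching ^ L).-1 m.
exists (t.+1 + j0 * L) => n le_n.
have L0 : 0 < L by [].
pose j := (n - t.+1) %/ L; pose i := (n - t.+1) %% L.
have en : n = t.+1 + j * L + i by rewrite -addnA -divn_eq subnKC //; lia.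
have jj0 : j0 <= j by rewrite /j leq_divRL //; lia.
rewrite en extension_sumD words_countD // words_countD //.
have b0 : 0 < branching ^ L by rewrite expn_gt0 (ltnW branching_gt1).
have : extension_sum (t.+1 + j * L) (extension_sum i avoids) [::] <=
    extension_sum (t.+1 + j * L) avoids [::] * branching ^ i.
  rewrite -extension_sumMr; apply: leq_extension_sum => w rw;
    rewrite add0n => sw.
  by apply: extension_sum_avoids; rewrite -?size_eq0 ?sw // addSn ltnW // ltnS
    leq_addr.
move=> /(leq_mul (leqnn m))/leq_trans; apply; rewrite mulnA leq_mul2r;
  apply/orP; right.
apply: leq_trans (leq_mul (leqnn m) (avoids_decay j)) _.
rewrite mulnCA leq_mul2l; apply/orP; right.
by rewrite [j * L]mulnC expnM -[X in _ <= X ^ _](prednK b0) j0P.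
Qed.

(* Contains the words of length at least [2 * t] whose cyclic reduction does not
   have the factor [u]. *)
Definition exceptional (w : seq (letter r)) :=
  (winv (take t w) == drop (size w - t) w) || avoids (take (size w - t) w).

(** The last [t] letters of a mirrored word are determined by the first ones, which gives the first
    summand; the other words avoid [u] within their first [n] letters. *)
Lemma extension_sum_exceptional n : t < n ->
  extension_sum (n + t) exceptional [::] <=
    words_count n + extension_sum n avoids [::] * branching ^ t.
Proof.
move=> tn; rewrite /words_count extension_sumD -extension_sumMr.
rewrite /extension_sum -big_split; apply: leq_sum => w rw /=.
have sw : size w = n by rewrite size_tuple.
have w0 : tval w != [::] by rewrite -size_eq0 sw; case: (n) tn.
set p := winv (take t w).
have exc w' : size w' = t -> exceptional (w ++ w') = (p == w') || avoids w.
  rewrite /exceptional size_cat => ->.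
    rewrite addnK (take_size_cat _ (erefl (size w))) drop_size_cat //.
  by rewrite takel_cat // sw ltnW.
apply: leq_trans (_ : extension_sum t (fun x => drop n x == p) w +
  extension_sum t (fun=> 1 * avoids w) w <= _).
  rewrite /extension_sum -big_split; apply: leq_sum => w' _ /=.
  rewrite exc ?size_tuple // drop_size_cat // mul1n eq_sym.
  by case: (_ == _); case: (avoids _).
rewrite leq_add ?extension_sumMr ?extension_sum1 1?mulnC //.
apply: (@extension_sum_le1 t (fun x => drop n x == p)) => w1 w2 _ _.
by rewrite !drop_size_cat // => /eqP -> /eqP ->.
Qed.

End Avoiding.

(** Each kind of exceptional word makes up at most the fraction [1 / (2 * m)]: the mirrored ones
    because [2 * m = t <= branching ^ t], the others by [avoids_negligible]. *)
Lemma exceptional_negligible u (Q : pred (seq (letter r))) : reduced u ->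
  (forall (t : nat) w, reduced w -> 2 * t <= size w -> ~~ exceptional u t w ->
    ~~ Q w) ->
  forall m, exists n0, forall n, n0 <= n ->
    m * extension_sum n Q [::] <= words_count n.
Proof.
move=> ru QP m; pose t := 2 * m.
have [n0 n0P] := @avoids_negligible u t ru (2 * m).
exists (n0 + 2 * t).+1 => n le_n.
have [en tn] : n = n - t + t /\ t < n - t by lia.
rewrite -(leq_pmul2l (ltn0Sn 1)) mulnA.
apply: leq_trans (_ : 2 * m * extension_sum n (exceptional u t) [::] <= _).
  rewrite leq_mul2l; apply/orP; right; apply: leq_extension_sum => w rw.
  rewrite add0n => sw; have st : 2 * t <= size w by rewrite sw; lia.
  by have := QP t w rw st; case: (exceptional u t w);
    case: (Q w) => // /(_ isT).
rewrite {1}en.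
apply: leq_trans (leq_mul (leqnn _) (extension_sum_exceptional u tn)) _.
have -> : words_count n = words_count (n - t) * branching ^ t.
  by rewrite {1}en words_countD //; lia.
rewrite mulnDr mulnA [2 * (_ * _)]mul2n -addnn leq_add //.
  rewrite mulnC leq_mul2l; apply/orP; right.
  exact: ltnW (ltn_expl t branching_gt1).
by rewrite leq_mul2r n0P ?orbT //; lia.
Qed.

End Counting.

(** * Cardinalities and averages *)

Section FiniteCounting.

Lemma card_sig_pred (T : finType) (P Q : pred T) :
  #|[pred x : {w | P w} | Q (val x)]| = #|[pred w | P w && Q w]|.
Proof.
rewrite -(fintype.card_image val_inj); apply: eq_card => w.
apply/fintype.imageP/andP => [[x Qx ->]|[Pw Qw]]; first by split;
  [exact: valP|exact: Qx].
by exists (Sub w Pw); rewrite ?inE SubK.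
Qed.

Lemma card_bseq_size (T : finType) n l (Q : pred (seq T)) : l <= n ->
  #|[pred w : n.-bseq T | (size w == l) && Q w]| =
  #|[pred w : l.-tuple T | Q w]|.
Proof.
move=> ln; have sz (w : l.-tuple T) : size w <= n by rewrite size_tuple.
pose f w : n.-bseq T := Bseq (sz w).
have injf : injective f.
  by move=> w w' e; apply: val_inj; exact: (congr1 (@bseqval _ _) e).
rewrite -(fintype.card_image injf); apply: eq_card => w.
apply/andP/fintype.imageP => [[/eqP wl Qw]|[x Qx ->]];
  last by rewrite size_tuple eqxx.
have wl' : size w == l by rewrite wl.
by exists (Tuple wl') => //; apply: val_inj.
Qed.

Lemma card_bseq (T : finType) n (Q : pred (seq T)) :
  #|[pred w : n.-bseq T | (0 < size w) && Q w]| =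
  \sum_(l < n) #|[pred w : l.+1.-tuple T | Q w]|.
Proof.
(* Words are sorted by their length minus one; [inord] needs a nonempty ordinal type, so [n = 0] is
   treated apart. *)
rewrite -sum1_card (partition_big (fun w : n.-bseq T => inord (size w).-1 :
  'I_n.-1.+1) xpredT) //=.
case: n => [|n]; first by rewrite big_ord0 big1 // => i _;
  rewrite big_pred0 // => -[[|a s]].
apply: eq_bigr => l _ /=; rewrite -(@card_bseq_size _ n.+1) // sum1_card.
apply: eq_card => w; rewrite unfold_in !inE -val_eqE /=; have := size_bseq w.
case: (size w) => [|m] /=; first by [].
by move=> mn; rewrite inordK // eqSS andbC.
Qed.

(** A coordinate of a uniform tuple is uniform; the equality of proportions is written without
    division. *)
Lemma card_ffun_at (T : finType) N (i0 : 'I_N) (Q : pred T) :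
  #|[pred w : {ffun 'I_N -> T} | Q (w i0)]| * #|T| = #|Q| * #|{ffun 'I_N -> T}|.
Proof.
pose F i := if i == i0 then Q else predT.
have -> : #|[pred w : {ffun 'I_N -> T} | Q (w i0)]| = #|family F|.
  apply: eq_card => w; rewrite !inE; apply/idP/familyP => [Qw i|/(_ i0)].
    by rewrite /F; case: eqVneq => // ->.
  by rewrite /F eqxx.
rewrite card_ffun card_ord card_family foldrE big_map big_enum /=.
rewrite (bigD1 i0) //= {1}/F eqxx (eq_bigr (fun=> #|T|)) => [|i]; last first.
  by rewrite /F => /negPf ->.
have -> : \prod_(i < N | i != i0) #|T| = #|T| ^ N.-1.
  by rewrite (eq_bigl (mem (predC1 i0))) // prod_nat_const cardC1 card_ord.
by rewrite -mulnA -expnSr prednK // (leq_trans _ (ltn_ord i0)).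
Qed.

(** The terms from [l0] on are small by assumption. The earlier ones have a fixed sum, outweighed by
    the total, which is at least [n]. Each portion receives one half. *)
Lemma average_negligible (b N : nat -> nat) :
  (forall l, b l <= N l) -> (forall l, 0 < N l) ->
  (forall m, exists n0, forall n, n0 <= n -> m * b n <= N n) ->
  forall m, exists n0, forall n, n0 <= n ->
    m * (\sum_(l < n) b l) <= \sum_(l < n) N l.
Proof.
move=> bN N0 neg m; have [l0 l0P] := neg (2 * m).
exists (l0 + \sum_(l < l0) 2 * m * N l) => n le_n.
have n_le : n <= \sum_(l < n) N l.
  by rewrite -[leqLHS]card_ord -sum1_card; apply: leq_sum.
rewrite -(leq_pmul2l (ltn0Sn 1)) [leqRHS]mul2n -addnn mulnA big_distrr /=.
have l0n : l0 <= n by lia.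
rewrite -{1}(big_mkord xpredT (fun l => 2 * m * b l)) (big_cat_nat (leq0n l0)
  l0n) //=.
apply: leq_add.
  apply: leq_trans n_le; apply: leq_trans (leq_trans (leq_addl l0 _) le_n).
  by rewrite big_mkord; apply: leq_sum => l _; rewrite leq_mul2l bN orbT.
rewrite -[leqRHS](big_mkord xpredT) [leqRHS](big_cat_nat (leq0n l0) l0n) //=.
apply: leq_trans (leq_addl _ _); rewrite big_nat [leqRHS]big_nat.
by apply: leq_sum => l /andP[/l0P].
Qed.

End FiniteCounting.

(** * Rarity of words without a full root *)

Section BadWords.
Variables (r : nat).
Hypothesis hr : 2 <= r.

Definition bad_word m (s : seq (letter r)) : bool :=
  ~~ `[< full m (free_root (cyclic_reduction (elt s))) >].

Lemma bad_word_negligible m c : exists n0, forall n, n0 <= n ->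
  c * extension_sum n (bad_word m) [::] <= words_count r n.
Proof.
have [u ru uP] := universal_word m hr.
apply: (exceptional_negligible hr ru) => t w rw tw.
rewrite negb_or negbK => /andP[nmirror uw].
rewrite negbK; apply/asboolP; apply: (full_root_of_infix uP).
  (* The empty word counts as mirrored. *)
  apply: contraNneq nmirror => w1.
  by have -> : w = [::]; rewrite // -(word_elt rw) w1.
have := @infix_cyclic_reduction r (elt w) t;
  rewrite word_elt // => /(_ tw nmirror).
exact: infix_trans.
Qed.

Lemma card_words n (Q : pred (seq (letter r))) :
  #|[pred w : n.-tuple (letter r) | reduced w && Q w]| = extension_sum n Q [::].
Proof.
rewrite -sum1_card big_mkcondr; apply: eq_bigr => w _ /=.
by case: (Q w).
Qed.

Lemma card_sphere n : #|{: sphere r n}| = words_count r n.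
Proof. by rewrite card_sub -[RHS](card_words n predT); apply: eq_card => w;
  rewrite !inE andbT. Qed.

Lemma card_sphere_bad n m :
  #|[pred w : sphere r n | bad_word m (sphere_elt w)]| =
  extension_sum n (bad_word m) [::].
Proof. by rewrite -card_words -card_sig_pred; apply: eq_card. Qed.

Lemma card_ball n :
  #|{: nontrivial_ball r n}| = \sum_(l < n) words_count r l.+1.
Proof.
rewrite card_sub.
transitivity #|[pred w : n.-bseq (letter r) |
    (0 < size w) && (reduced w && true)]|.
  by apply: eq_card => w; rewrite !inE andbT andbC.
rewrite (card_bseq n (fun w => reduced w && true)).
by apply: eq_bigr => l _; rewrite (card_words _ predT).
Qed.

Lemma card_ball_bad n m :
  #|[pred w : nontrivial_ball r n | bad_word m (ball_elt w)]| =
  \sum_(l < n) extension_sum l.+1 (bad_word m) [::].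
Proof.
transitivity #|[pred w : n.-bseq (letter r) |
    (0 < size w) && (reduced w && bad_word m w)]|.
  transitivity #|[pred w : n.-bseq (letter r) |
      (reduced w && (0 < size w)) && bad_word m w]|.
    by rewrite -card_sig_pred; apply: eq_card.
  by apply: eq_card => w; rewrite !inE andbCA andbA.
rewrite (card_bseq n (fun w => reduced w && bad_word m w)).
by apply: eq_bigr => l _; rewrite card_words.
Qed.

Lemma words_count_gt0 n : 0 < words_count r n.
Proof.
case: n => [|n]; first by rewrite /words_count extension_sum0.
rewrite -[n.+1]addn1 addnC words_countD // muln_gt0 expn_gt0.
rewrite (ltnW (branching_gt1 hr)) /words_count extension_sumS.
by rewrite (bigD1 (Ordinal (ltnW hr), true)) //= extension_sum0.
Qed.

Lemma ball_bad_negligible m c : exists n0, forall n, n0 <= n ->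
  c * #|[pred w : nontrivial_ball r n | bad_word m (ball_elt w)]| <=
    #|{: nontrivial_ball r n}|.
Proof.
have [||d|n0 n0P] := @average_negligible
  (fun l => extension_sum l.+1 (bad_word m) [::]) (fun l => words_count r l.+1)
    _ _ _ c.
- by move=> l; apply: leq_extension_sum => w _ _; case: (bad_word m w).
- by move=> l; exact: words_count_gt0.
- have [n0 n0P] := bad_word_negligible m d.
  by exists n0 => n nn0; apply: n0P; apply: leqW.
by exists n0 => n; rewrite card_ball card_ball_bad; exact: n0P.
Qed.

Lemma sphere_bad_negligible m c : exists n0, forall n, n0 <= n ->
  c * #|[pred w : sphere r n | bad_word m (sphere_elt w)]| <= #|{: sphere r n}|.
Proof.
have [n0 n0P] := bad_word_negligible m c.
by exists n0 => n; rewrite card_sphere card_sphere_bad; exact: n0P.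
Qed.

End BadWords.

(** * Probabilities *)

Local Open Scope classical_set_scope.
Local Open Scope ring_scope.
Import Order.TTheory GRing.Theory Num.Theory.

Section Probability.
Variable R : realType.

(** Failure of [E] forces the coordinate [i0] to be bad, which has probability at most [1 / c]. *)
Lemma counting_prob_ffun_ge (T : finType) (N c : nat) (i0 : 'I_N)
    (E : set {ffun 'I_N -> T}) (bad : pred T) :
  (0 < c)%N -> (0 < #|T|)%N -> (c * #|bad| <= #|T|)%N ->
  (forall w : {ffun 'I_N -> T}, ~~ bad (w i0) -> E w) ->
  1 - c%:R^-1 <= counting_prob R E <= 1.
Proof.
move=> c0 T0 cb badE; rewrite /counting_prob; set total := #|{: {ffun _ -> _}}|.
have total0 : (0 < total)%N by rewrite /total card_ffun expn_gt0 T0.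
set good := #|_|; set nbad := #|[pred w : {ffun 'I_N -> T} | bad (w i0)]|.
have total_le : (total <= good + nbad)%N.
  rewrite -cardUI; apply: leq_trans (leq_addr _ _).
  apply: subset_leq_card; apply/fintype.subsetP => w _; rewrite !inE.
  case: (boolP (bad (w i0))) => [_|/badE Ew]; rewrite ?orbT //.
  by apply/orP; left; apply/asboolP.
have nbad_le : (c * nbad <= total)%N.
  rewrite -(leq_pmul2r T0) -mulnA card_ffun_at mulnA [leqRHS]mulnC.
  by rewrite leq_mul2r cb orbT.
have tR : (0 : R) < total%:R by rewrite ltr0n.
have cR : (0 : R) < c%:R by rewrite ltr0n.
rewrite ler_pdivlMr // ler_pdivrMr // mul1r ler_nat max_card andbT.
rewrite mulrBl mul1r lerBlDr.
have : (total%:R : R) <= good%:R + nbad%:R by rewrite -natrD ler_nat.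
move=> /le_trans; apply; rewrite lerD2l ler_pdivlMl //.
by rewrite -natrM ler_nat.
Qed.

Lemma cvg_to1 (f : nat -> R) :
  (forall c, (0 < c)%N -> exists n0, forall n, (n0 <= n)%N ->
     1 - c%:R^-1 <= f n <= 1) -> f @ \oo --> (1 : R).
Proof.
move=> fP; apply/cvgrPdist_le => e e0.
pose c := (Num.truncn e^-1).+1; have [n0 n0P] := fP c isT.
exists n0 => // n /= /n0P/andP[f1 f2]; rewrite ger0_norm ?subr_ge0 //.
rewrite lerBlDr addrC -lerBlDr; apply: le_trans f1; rewrite lerD2l lerN2.
by rewrite invf_ple ?posrE ?ltr0n // ltW // truncnS_gt.
Qed.

End Probability.

Lemma induced_connected_without_small_cut_set (I : finType) (r k : nat)
    (F : I -> free_group r) (i0 : I) : (2 <= r)%N -> (0 < k)%N ->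
  (forall i, F i != 1%g) -> ~~ bad_word (4 * k) (F i0) ->
  connected_without_small_cut_set
    (bowditch_boundary (induced_peripheral_structure
       [set F i | i in [set: I]])) k.
Proof.
move=> hr hk F1; rewrite negbK elt_word => /asboolP fg.
apply: connected_of_joins_short_paths => //.
apply: (joins_short_paths_of_full _ _ _ fg).
- by apply: finite_image; exact: finite_finset.
- by move=> [i _ Fi1]; have := F1 i; rewrite Fi1 eqxx.
- by exists i0.
Qed.

Theorem theorem1p1 (R : realType) (r k : nat) (hr : (2 <= r)%N) (hk : (0 < k)%N) :
  (forall m : nat, (1 <= m)%N ->
     (fun n : nat => few_words_prob R r k m n) @ \oo --> (1 : R)) /\
  (forall d : R, 0 < d < 1 ->
     (fun n : nat => density_prob r k d n) @ \oo --> (1 : R)).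
Proof.
split=> [m m0|d /andP[d0 _]]; apply: cvg_to1 => c c0.
  have [n0 n0P] := ball_bad_negligible hr (4 * k) c.
  (* For [n = 0] the ball has no nontrivial element. *)
  exists n0.+1 => n n0n.
  apply: (@counting_prob_ffun_ge R _ _ c (Ordinal m0) _
    (fun w => bad_word (4 * k) (ball_elt w))) => //.
  - rewrite card_ball; case: n n0n => // n _.
    by rewrite big_ord_recl addn_gt0 words_count_gt0.
  - by apply: n0P; apply: ltnW.
  - move=> w gw.
    apply: (@induced_connected_without_small_cut_set _ _ _
      (fun i => ball_elt (w i))) gw => // i.
    have /andP[_] := valP (w i); apply: contraTneq => e.
    by have := congr1 (fun g : free_group r => size g) e => /= ->.
have [n0 n0P] := sphere_bad_negligible hr (4 * k) c.
(* For [n = 0] the only word on the sphere is trivial. *)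
exists n0.+1 => n n0n.
(* A base of at least [1] and a nonnegative exponent ensure that at least one word is drawn. *)
have N0 : (0 < density_count r d n)%N.
  rewrite /density_count truncn_gt0 -[leLHS](powRr0 (2 * r - 1)%N%:R).
  apply: ler_powR; first by rewrite ler1n; lia.
  by rewrite mulr_ge0 // ltW.
apply: (@counting_prob_ffun_ge R _ _ c (Ordinal N0) _
  (fun w => bad_word (4 * k) (sphere_elt w))) => //.
- by rewrite card_sphere words_count_gt0.
- by apply: n0P; apply: ltnW.
- move=> w gw.
  apply: (@induced_connected_without_small_cut_set _ _ _
    (fun i => sphere_elt (w i))) gw => // i.
  apply: contraTneq n0n => e.
  have := congr1 (fun g : free_group r => size g) e => /=.
  by rewrite size_tuple => ->.
Qed.
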